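(* Let $\mathbb{F}$ be a field of positive characteristic, let $d\geq 1$ be an integer, and let $G$ be a finitely generated group which is isomorphic to a subgroup of $GL(d,\mathbb{F})$. Then there exists a complete CAT(0) space $X$ on which $G$ acts properly and semisimply by isometries.
   Context: An action of a group $G$ by isometries on a metric space $(X,d)$ is proper if for every $x\in X$ there is $r>0$ such that the set $\{g\in G: g(B(x,r))\cap B(x,r)\neq\emptyset\}$ is finite, where $B(x,r)$ is the open ball. The action is semisimple if for every $g\in G$ the displacement function $x\mapsto d(x,g(x))$ attains its infimum over $X$. The space $X$ is not required to be a proper metric space and the action is not required to be cocompact. *)

(* Defs.v *)
From HB Require Import structures.
From mathcomp Require Import all_boot all_order all_algebra.
From mathcomp Require Import all_classical all_reals all_analysis.
Set Implicit Arguments.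
Unset Strict Implicit.
Unset Printing Implicit Defensive.
Import Order.TTheory GRing.Theory Num.Theory.
Local Open Scope classical_set_scope.
Local Open Scope ring_scope.

(* The library's ['GL_d[F]] is only available over finite rings. *)
Record GL (d : nat) (F : fieldType) :=
  GLOf { gl_mx :> 'M[F]_d ; gl_mx_unit : gl_mx \in unitmx }.

HB.instance Definition _ d F := [isSub for @gl_mx d F].
HB.instance Definition _ d F := [Choice of GL d F by <:].

Section GLGroup.
Variables (d : nat) (F : fieldType).
Implicit Types x y z : GL d F.

Fact GL_one_subproof : (1%:M : 'M[F]_d) \in unitmx.
Proof. exact: unitmx1. Qed.

Fact GL_mul_subproof x y : gl_mx x *m gl_mx y \in unitmx.
Proof. by rewrite unitmx_mul !gl_mx_unit. Qed.

Fact GL_inv_subproof x : invmx (gl_mx x) \in unitmx.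
Proof. by rewrite unitmx_inv gl_mx_unit. Qed.

Definition GL_one : GL d F := GLOf GL_one_subproof.
Definition GL_mul x y : GL d F := GLOf (GL_mul_subproof x y).
Definition GL_inv x : GL d F := GLOf (GL_inv_subproof x).

Fact GL_mulA : associative GL_mul.
Proof. by move=> x y z; apply: val_inj; rewrite /= mulmxA. Qed.

Fact GL_mul1 : left_id GL_one GL_mul.
Proof. by move=> x; apply: val_inj; rewrite /= mul1mx. Qed.

Fact GL_mulr1 : right_id GL_one GL_mul.
Proof. by move=> x; apply: val_inj; rewrite /= mulmx1. Qed.

Fact GL_mulV : left_inverse GL_one GL_inv GL_mul.
Proof. by move=> x; apply: val_inj; rewrite /= mulVmx ?gl_mx_unit. Qed.

Fact GL_mulrV : right_inverse GL_one GL_inv GL_mul.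
Proof. by move=> x; apply: val_inj; rewrite /= mulmxV ?gl_mx_unit. Qed.

HB.instance Definition _ := isGroup.Build (GL d F)
  GL_mulA GL_mul1 GL_mulr1 GL_mulV GL_mulrV.
End GLGroup.

Definition finitely_generated (G : groupType) : Prop :=
  exists s : seq G, forall H : {pred G},
    group_closed H -> {subset s <= H} -> forall g : G, g \in H.

Definition isomorphic_to_subgroup (G L : groupType) : Prop :=
  exists (H : {pred L}) (f : {multiplicative G -> L}),
    [/\ group_closed H, injective f &
        forall h : L, h \in H <-> exists g : G, f g = h].

#[short(type="completeMetricType")]
HB.structure Definition CompleteMetric (R : numDomainType) :=
  { X of CompletePseudoMetric R X & Metric R X }.

Section CAT0.
Variables (R : realType) (X : metricType R).
Implicit Types (p q r x y : X) (c : R -> X).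

(* Only the values of [c] on the interval [0, mdist p q] are relevant. *)
Definition geodesic p q c : Prop :=
  [/\ c 0 = p, c (mdist p q) = q &
      {in `[0, mdist p q]%R &, forall s t, mdist (c s) (c t) = `|s - t|}].

Definition geodesic_space : Prop := forall p q, exists c, geodesic p q c.

(* The norm that the library puts on row vectors is the sup norm. *)
Definition edist (u v : 'rV[R]_2) : R :=
  Num.sqrt (\sum_(i < 2) (u 0 i - v 0 i) ^+ 2).

Definition esegment (u v : 'rV[R]_2) : set 'rV[R]_2 :=
  [set w | exists2 t : R, t \in `[0, 1]%R & w = (1 - t) *: u + t *: v].

Definition comparison_triangle p q r (p' q' r' : 'rV[R]_2) : Prop :=
  [/\ edist p' q' = mdist p q, edist q' r' = mdist q r &
      edist r' p' = mdist r p].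

(* [x] lies on the side [c] from [p] to [q], and [x'] is its comparison point
   on the segment from [p'] to [q']. *)
Definition side_comparison_point p q c (p' q' : 'rV[R]_2)
    x (x' : 'rV[R]_2) : Prop :=
  [/\ exists2 s, s \in `[0, mdist p q]%R & c s = x,
      esegment p' q' x' & edist p' x' = mdist p x].

Definition comparison_point p q r cpq cqr crp (p' q' r' : 'rV[R]_2)
    x (x' : 'rV[R]_2) : Prop :=
  [\/ side_comparison_point p q cpq p' q' x x',
      side_comparison_point q r cqr q' r' x x' |
      side_comparison_point r p crp r' p' x x'].

Definition CAT0 : Prop :=
  geodesic_space /\
  forall p q r cpq cqr crp,
    geodesic p q cpq -> geodesic q r cqr -> geodesic r p crp ->
  forall p' q' r' : 'rV[R]_2, comparison_triangle p q r p' q' r' ->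
  forall x y (x' y' : 'rV[R]_2),
    comparison_point p q r cpq cqr crp p' q' r' x x' ->
    comparison_point p q r cpq cqr crp p' q' r' y y' ->
    mdist x y <= edist x' y'.

End CAT0.

Section Actions.
Variables (R : realType) (G : groupType) (X : metricType R).
Implicit Types act : G -> X -> X.

Definition isometric_action act : Prop :=
  [/\ forall x, act 1%g x = x,
      forall g h x, act (g * h)%g x = act g (act h x) &
      forall g x y, mdist (act g x) (act g y) = mdist x y].

Definition proper_action act : Prop :=
  forall x, exists2 r : R, 0 < r &
    finite_set [set g | (act g @` ball x r) `&` ball x r !=set0].

Definition displacement act (g : G) (x : X) : R := mdist x (act g x).

Definition semisimple_action act : Prop :=
  forall g, exists x, displacement act g x = inf (range (displacement act g)).

End Actions.

(* Main.v *)
Require Import Defs.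
From HB Require Import structures.
From mathcomp Require Import all_boot all_order all_algebra all_fingroup.
From mathcomp Require Import all_classical all_reals all_analysis.
From mathcomp Require Import ring lra zify.
(* The library has another [edist]. *)
Import Defs.
Set Implicit Arguments.
Unset Strict Implicit.
Unset Printing Implicit Defensive.
Import Order.TTheory GRing.Theory Num.Theory.
Import numFieldNormedType.Exports.
Local Open Scope ring_scope.

(** The group acts on a Bruhat-Tits building, realised as a space of norms.

    Let [A] be the ring generated by the matrix entries of [G].  Noether
    normalisation makes [A] finite over a polynomial ring [B = F_p[y_1, ..., y_m]];
    clearing denominators in a maximal [B]-independent family of the [B]-module
    [A^d] turns [G] into matrices with entries in [1/D B], and only finitely many
    elements of [B] have bounded total degree.  Rewriting [y_i] as [y_i T] makes the
    total degree the degree in [T], so that [G] is represented over a field [K] with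
    a discrete valuation and only finitely many elements of [G] have bounded
    entries.

    [GL_N(K)] acts on the norms [max_k |x_k| exp a_k] in the bases of [K^N], and a
    basis gives a chart from [R^N].  Gaussian elimination with a suitable pivot
    shows [GL_N(K) = I W I], where [I] fixes the alcove
    [0 <= a_1 <= ... <= a_N <= 1] pointwise and [W] is the affine Weyl group.  Hence
    there are nonexpansive retractions onto charts centred at an alcove, which make
    the Euclidean distance of a common chart a CAT(0) metric.  As the alcove is
    compact and [W] acts discretely, the space is complete and isometries coming
    from [GL_N(K)] attain their minimal displacement.  A bound on the displacement
    of a point bounds matrix entries, so the action of [G] is proper. *)

(** * Euclidean norm *)

Section EuclideanNorm.
Variables (R : realType) (N : nat).
Implicit Types (u v w : 'rV[R]_N).

Definition enorm u : R := Num.sqrt (\sum_i u 0 i ^+ 2).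

Lemma enorm_ge0 u : 0 <= enorm u.
Proof. exact: sqrtr_ge0. Qed.

Lemma sqr_enorm u : enorm u ^+ 2 = \sum_i u 0 i ^+ 2.
Proof. by rewrite sqr_sqrtr// sumr_ge0// => i _; exact: sqr_ge0. Qed.

Lemma coord_le_enorm u i : `|u 0 i| <= enorm u.
Proof.
rewrite -(@ler_pXn2r _ 2)// ?nnegrE ?enorm_ge0//.
rewrite sqr_enorm real_normK ?num_real// (bigD1 i)//= lerDl.
by rewrite sumr_ge0// => j _; exact: sqr_ge0.
Qed.

Lemma enorm_eq0 u : enorm u = 0 -> u = 0.
Proof.
move=> u0; apply/rowP => i; rewrite mxE; apply/eqP.
by rewrite -normr_le0 -u0 coord_le_enorm.
Qed.

Lemma enormN u : enorm (- u) = enorm u.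
Proof.
by congr Num.sqrt; apply: eq_bigr => i _; rewrite mxE sqrrN.
Qed.

Lemma enorm0 : enorm 0 = 0.
Proof.
by rewrite /enorm big1 ?sqrtr0// => i _; rewrite mxE expr0n.
Qed.

Lemma enormZ a u : enorm (a *: u) = `|a| * enorm u.
Proof.
rewrite /enorm -sqrtr_sqr -sqrtrM ?sqr_ge0// mulr_sumr.
by congr Num.sqrt; apply: eq_bigr => i _; rewrite mxE exprMn.
Qed.

Lemma enorm_distC u v : enorm (u - v) = enorm (v - u).
Proof. by rewrite -enormN opprB. Qed.

Lemma enormD u v : enorm (u + v) <= enorm u + enorm v.
Proof.
have [u0|u0] := eqVneq (enorm u) 0.
  by rewrite (enorm_eq0 u0) enorm0 !add0r.
have [v0|v0] := eqVneq (enorm v) 0.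
  by rewrite (enorm_eq0 v0) enorm0 !addr0.
have up : 0 < enorm u by rewrite lt_neqAle eq_sym u0 enorm_ge0.
have vp : 0 < enorm v by rewrite lt_neqAle eq_sym v0 enorm_ge0.
rewrite -(@ler_pXn2r _ 2)// ?nnegrE ?addr_ge0 ?enorm_ge0//.
set A := enorm u; set B := enorm v; rewrite sqr_enorm.
(* With [x = u_i] and [y = v_i], the bound minus [(x + y)^2] is [(B x - A y)^2 / (A B)]; summed over
   [i], the bound becomes [(A + B)^2]. *)
apply: (@le_trans _ _
  (\sum_i ((1 + B / A) * u 0 i ^+ 2 + (1 + A / B) * v 0 i ^+ 2))).
  apply: ler_sum => i _; rewrite mxE -subr_ge0.
  have -> : (1 + B / A) * u 0 i ^+ 2 + (1 + A / B) * v 0 i ^+ 2 -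
    (u 0 i + v 0 i) ^+ 2 = (B * u 0 i - A * v 0 i) ^+ 2 / (A * B).
    by field; rewrite u0 v0.
  by rewrite divr_ge0 ?sqr_ge0 ?mulr_ge0 ?enorm_ge0.
rewrite big_split/= -!mulr_sumr -!sqr_enorm -/A -/B.
rewrite le_eqVlt; apply/orP; left; apply/eqP; field; by rewrite u0 v0.
Qed.

Lemma enorm_triangle v u w : enorm (u - w) <= enorm (u - v) + enorm (v - w).
Proof. by rewrite -(subrKA v u) enormD. Qed.

Lemma enorm_stewart (t : R) u v w :
  enorm (w - ((1 - t) *: u + t *: v)) ^+ 2 =
  (1 - t) * enorm (w - u) ^+ 2 + t * enorm (w - v) ^+ 2
  - t * (1 - t) * enorm (u - v) ^+ 2.
Proof.
rewrite !sqr_enorm !mulr_sumr -big_split -sumrB/=.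
by apply: eq_bigr => i _; rewrite !mxE; ring.
Qed.

Lemma enorm_le_sum u : enorm u <= \sum_i `|u 0 i|.
Proof.
have s0 (r : seq 'I_N) : 0 <= \sum_(i <- r) `|u 0 i|.
  by apply: sumr_ge0.
rewrite -(@ler_pXn2r _ 2)// ?nnegrE ?enorm_ge0// sqr_enorm.
elim: (index_enum _) => [|i r IH]; first by rewrite !big_nil expr0n.
rewrite !big_cons sqrrD real_normK ?num_real//.
rewrite -addrA lerD2l (le_trans IH)// lerDr mulrn_wge0// mulr_ge0//.
Qed.

End EuclideanNorm.

(** * Complete metric spaces from a distance *)

(** Completeness only asks for a cluster point of a Cauchy sequence, which is what compactness of
    the alcove supplies later. *)
Record complete_distance (R : realType) := CompleteDistance {
  cd_sort : pointedType;
  cd_dist : cd_sort -> cd_sort -> R;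
  cd_distxx : forall x, cd_dist x x = 0;
  cd_positivity : forall x y, cd_dist x y = 0 -> x = y;
  cd_sym : forall x y, cd_dist x y = cd_dist y x;
  cd_triangle : forall y x z, cd_dist x z <= cd_dist x y + cd_dist y z;
  cd_complete : forall x : nat -> cd_sort,
    (forall e, 0 < e -> exists n0, forall n m, (n0 <= n)%N -> (n0 <= m)%N ->
       cd_dist (x n) (x m) < e) ->
    exists y, forall e, 0 < e -> forall n0, exists2 n, (n0 <= n)%N &
       cd_dist (x n) y < e }.

Definition cd_space (R : realType) (D : complete_distance R) : Type := cd_sort D.

Section CompleteDistanceSpace.
Variables (R : realType) (D : complete_distance R).
Local Notation X := (cd_space D).

HB.instance Definition _ := Pointed.on X.
HB.instance Definition _ := @isMetric.Build R X (@cd_dist R D)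
  (@cd_distxx R D) (@cd_positivity R D) (@cd_sym R D) (@cd_triangle R D).

Let mdistE (x y : X) : mdist x y = cd_dist x y.
Proof. by []. Qed.

(** A Cauchy filter contains balls of radius [1/(n+1)] for all [n]. Any two of them meet, so their
    centres form a Cauchy sequence, and its cluster point is a limit of the filter. *)
Fact cd_space_complete (F : set_system X) :
  ProperFilter F -> cauchy F -> cvg F.
Proof.
move=> FF cF.
have ball_ex (n : nat) : exists x : X, F (ball x n.+1%:R^-1).
  have n0 : 0 < n.+1%:R^-1 :> R by rewrite invr_gt0.
  have [[A B] [/= FA FB] AB] := cF _ (entourage_ball X (PosNum n0)).
  have [x [Ax Bx]] : (A `&` B !=set0)%classic.
    exact: (@filter_ex _ F FF _ (@filterI _ F _ _ _ FA FB)).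
  by exists x; apply: filterS FB => z Bz; apply: (AB (x, z)); split.
have [x Fx] := choice ball_ex.
have xx n m : cd_dist (x n) (x m) < n.+1%:R^-1 + m.+1%:R^-1.
  have [z [zn zm]] : (ball (x n) n.+1%:R^-1 `&` ball (x m) m.+1%:R^-1 !=set0)%classic.
    exact: (@filter_ex _ F FF _ (@filterI _ F _ _ _ (Fx n) (Fx m))).
  rewrite !ballEmdist /= !mdistE in zn zm.
  apply: le_lt_trans (cd_triangle z _ _) _.
  by rewrite ltrD// cd_sym.
have small e : 0 < e -> exists n0, forall n, (n0 <= n)%N -> n.+1%:R^-1 < e :> R.
  move=> e0; have [n0 _ n0P] := near_infty_natSinv_lt (PosNum e0).
  by exists n0 => n n0n; exact: (n0P n).
have [e e0|y yP] := @cd_complete R D x.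
  have [n0 n0P] := small (e / 2) (divr_gt0 e0 (ltr0n _ 2)).
  exists n0 => n m nn mm; apply: lt_trans (xx n m) _.
  by rewrite [e]splitr ltrD// n0P.
apply: (@cvgP _ _ (y : X)); apply/cvg_ballP => e e0.
have e2 : 0 < e / 2 by rewrite divr_gt0.
have [n0 n0P] := small _ e2.
have [n n0n yn] := yP _ e2 n0.
apply: filterS (Fx n) => z; rewrite !ballEmdist /= !mdistE => zn.
apply: le_lt_trans (cd_triangle (x n) _ _) _.
rewrite cd_sym [e]splitr ltrD//.
by apply: lt_trans zn _; exact: n0P.
Qed.

HB.instance Definition _ := Uniform_isComplete.Build X cd_space_complete.

Definition cd_complete_metric : completeMetricType R := X.

Lemma cd_mdistE (x y : cd_complete_metric) :
  mdist x y = @cd_dist R D x y.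
Proof. by []. Qed.

End CompleteDistanceSpace.

(** * CAT(0) from the semi-parallelogram inequality *)

Lemma edistE (R : realType) (u v : 'rV[R]_2) : edist u v = enorm (u - v).
Proof. by congr Num.sqrt; apply: eq_bigr => i _; rewrite !mxE. Qed.

Section SemiParallelogram.
Variables (R : realType) (X : metricType R).
Implicit Types (p q r x y z : X).

(** Stewart's identity [enorm_stewart] with [<=] for [=]; at [t = 1/2] it is the semi-parallelogram
    inequality of Bruhat and Tits. *)
Definition stewart_le p q m (t : R) := forall z,
  mdist z m ^+ 2 <= (1 - t) * mdist z p ^+ 2 + t * mdist z q ^+ 2
                    - t * (1 - t) * mdist p q ^+ 2.

Hypothesis geod : forall p q, exists c : R -> X,
  [/\ c 0 = p, c 1 = q,
      {in `[0, 1] &, forall s t, mdist (c s) (c t) = `|s - t| * mdist p q} &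
      {in `[0, 1], forall t, stewart_le p q (c t) t}].

(* Applied to [z = x], the inequality forces [x] to be the point [c t]. *)
Lemma stewart_le_point p q x (t : R) : t \in `[0, 1] ->
  mdist p x = t * mdist p q -> mdist x q = (1 - t) * mdist p q ->
  stewart_le p q x t.
Proof.
move=> t01 px xq; have [c [_ _ _ /(_ _ t01) ct]] := geod p q.
suff -> : x = c t by [].
apply: mdist_positivity; apply/eqP; rewrite -sqrf_eq0 eq_le sqr_ge0 andbT.
apply: le_trans (ct x) _; rewrite (metric_sym x p) px xq.
rewrite le_eqVlt; apply/orP; left; apply/eqP; ring.
Qed.

(** The parameter [t] is read off the comparison segment and not as a quotient of lengths, so that a
    side of length 0 needs no separate case. *)
Lemma comparison_stewart p q c (p' q' : 'rV[R]_2) x (x' : 'rV[R]_2) :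
  geodesic p q c -> edist p' q' = mdist p q ->
  side_comparison_point p q c p' q' x x' ->
  exists2 t, t \in `[0, 1] & x' = (1 - t) *: p' + t *: q' /\ stewart_le p q x t.
Proof.
move=> [c0 cD cg] pq' [[s sD cs] [t t01 x't] p'x'].
have D0 := mdist_ge0 p q.
have in0 : 0 \in `[0, mdist p q] by rewrite in_itv /= lexx.
have inD : mdist p q \in `[0, mdist p q] by rewrite in_itv /= D0 lexx.
move: (sD) (t01); rewrite !in_itv /= => /andP[s0 sD'] /andP[t0 t1].
have px : mdist p x = s by rewrite -c0 -cs cg// sub0r normrN ger0_norm.
have xq : mdist x q = mdist p q - s.
  by rewrite -[in LHS]cD -cs cg// distrC ger0_norm// subr_ge0.
have st : s = t * mdist p q.
  rewrite -px -p'x' -pq' x't !edistE.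
  have -> : p' - ((1 - t) *: p' + t *: q') = t *: (p' - q').
    by apply/rowP => i; rewrite !mxE; ring.
  by rewrite enormZ ger0_norm.
exists t => //; split=> //; apply: stewart_le_point => //.
  by rewrite px.
by rewrite xq st; ring.
Qed.

(** Distances between vertices agree with the model. Stewart's inequality in [X] and the identity in
    the plane carry the comparison from the ends of a side to a point on it: first to [y], seen from
    the ends of the side of [x], then to [x]. *)
Lemma stewart_CAT0 : CAT0 X.
Proof.
split=> [p q|p q r cpq cqr crp gpq gqr grp p' q' r' [pq' qr' rp'] x y x' y' hx hy].
  have [c [c0 c1 cg _]] := geod p q.
  (* Rescaling to arc length; for [p = q] the division by zero returns 0, where [c] takes the value
     [p]. *)
  exists (fun s => c (s / mdist p q)); split; first by rewrite mul0r.
    have [D0|D0] := eqVneq (mdist p q) 0.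
      by rewrite D0 mul0r c0; apply: mdist_positivity.
    by rewrite divff.
  have [D0|D0] := eqVneq (mdist p q) 0.
    move=> s t; rewrite D0 !in_itv /= => /le_anti <- /le_anti <-.
    by rewrite mul0r mdistxx subrr normr0.
  have Dp : 0 < mdist p q by rewrite lt_neqAle eq_sym D0 mdist_ge0.
  move=> s t; rewrite !in_itv /= => /andP[s0 sD] /andP[t0 tD].
  rewrite cg ?in_itv/= ?divr_ge0 ?mdist_ge0 ?ler_pdivrMr ?mul1r//.
  by rewrite -mulrBl normrM (ger0_norm (x := _^-1)) ?invr_ge0 ?mdist_ge0// divfK.
have edistC (u v : 'rV[R]_2) : edist u v = edist v u.
  by rewrite !edistE enorm_distC.
have edistxx (u : 'rV[R]_2) : edist u u = 0 by rewrite edistE subrr enorm0.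
pose vertex v (v' : 'rV[R]_2) := [\/ v = p /\ v' = p', v = q /\ v' = q' | v = r /\ v' = r'].
have vP v v' w w' : vertex v v' -> vertex w w' -> mdist v w = edist v' w'.
  by case=> -[-> ->] [] [-> ->]; rewrite ?mdistxx ?edistxx//
    ?(metric_sym q p) ?(metric_sym r q) ?(metric_sym p r)
    ?(edistC q' p') ?(edistC r' q') ?(edistC p' r').
have side z (z' : 'rV[R]_2) : comparison_point p q r cpq cqr crp p' q' r' z z' ->
    exists v w v' w' t, [/\ vertex v v', vertex w w', t \in `[0, 1],
      z' = (1 - t) *: v' + t *: w' & stewart_le v w z t].
  case=> /comparison_stewart => [/(_ gpq pq')|/(_ gqr qr')|/(_ grp rp')].
  - by move=> [t t01 [? ?]]; exists p, q, p', q', t; split=> //;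
      [exact: Or31|exact: Or32].
  - by move=> [t t01 [? ?]]; exists q, r, q', r', t; split=> //;
      [exact: Or32|exact: Or33].
  - by move=> [t t01 [? ?]]; exists r, p, r', p', t; split=> //;
      [exact: Or33|exact: Or31].
have euc (u u' z : 'rV[R]_2) (t : R) : edist z ((1 - t) *: u + t *: u') ^+ 2 =
    (1 - t) * edist z u ^+ 2 + t * edist z u' ^+ 2 - t * (1 - t) * edist u u' ^+ 2.
  by rewrite !edistE enorm_stewart.
have mono a b : 0 <= a :> R -> 0 <= b -> a ^+ 2 <= b ^+ 2 -> a <= b.
  by move=> a0 b0; rewrite ler_pXn2r.
have e0 (u v : 'rV[R]_2) : 0 <= edist u v by exact: sqrtr_ge0.
have sle v w (v' w' : 'rV[R]_2) t (a b : X) (a' b' : 'rV[R]_2) : t \in `[0, 1] -> vertex v v' -> vertex w w' ->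
    stewart_le v w b t -> b' = (1 - t) *: v' + t *: w' ->
    mdist a v <= edist a' v' -> mdist a w <= edist a' w' ->
    mdist a b <= edist a' b'.
  move=> /[!in_itv]/= /andP[t0 t1] vv ww /(_ a) H -> av aw.
  apply: mono; rewrite ?mdist_ge0//; apply: le_trans H _.
  rewrite euc (vP _ _ _ _ vv ww) lerD2r.
  by apply: lerD; rewrite ler_wpM2l ?subr_ge0// ler_pXn2r ?nnegrE ?mdist_ge0.
have [v [w [v' [w' [t [vv ww t01 x'E sx]]]]]] := side _ _ hx.
have [v2 [w2 [v2' [w2' [t2 [vv2 ww2 t201 y'E sy]]]]]] := side _ _ hy.
rewrite metric_sym edistC.
apply: (sle _ _ _ _ _ _ _ _ _ t01 vv ww sx x'E).
  rewrite metric_sym edistC.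
  by apply: (sle _ _ _ _ _ _ _ _ _ t201 vv2 ww2 sy y'E);
    rewrite ?(vP _ _ _ _ vv vv2) ?(vP _ _ _ _ vv ww2).
rewrite metric_sym edistC.
by apply: (sle _ _ _ _ _ _ _ _ _ t201 vv2 ww2 sy y'E);
  rewrite ?(vP _ _ _ _ ww vv2) ?(vP _ _ _ _ ww ww2).
Qed.

End SemiParallelogram.

(** * Alcoves of the affine Weyl group *)

Lemma int_gap (R : realType) (x : R) :
  exists2 e : R, 0 < e & forall n : int, x = n%:~R \/ e <= `|x - n%:~R|.
Proof.
have /andP[fx xf] := floor_itv x; rewrite intrD in xf.
have [xE|xE] := eqVneq x (Num.floor x)%:~R.
  exists 1 => // n; have [->|nx] := eqVneq n (Num.floor x); first by left.
  right; rewrite xE -intrB -intr_norm ler1z -gtz0_ge1 normr_gt0.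
  by rewrite subr_eq0 eq_sym.
have fx' : (Num.floor x)%:~R < x by rewrite lt_neqAle eq_sym xE.
exists (Num.min (x - (Num.floor x)%:~R) ((Num.floor x)%:~R + 1 - x)).
  by rewrite lt_min !subr_gt0 fx' xf.
move=> n; right; rewrite ge_min; case: (lerP n (Num.floor x)) => nx.
  have nx' : n%:~R <= (Num.floor x)%:~R :> R by rewrite ler_int.
  by rewrite ger0_norm ?lerD2l ?lerN2 ?nx'//; lra.
have nx' : (Num.floor x)%:~R + 1 <= n%:~R :> R.
  by rewrite -(intrD _ _ 1) ler_int lezD1.
apply/orP; right; rewrite distrC ger0_norm; lra.
Qed.

Lemma common_positive (R : realType) (I : finType) (P : I -> R -> Prop) :
  (forall i e e', P i e -> e' <= e -> P i e') ->
  (forall i, exists2 e, 0 < e & P i e) ->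
  exists2 e : R, 0 < e & forall i, P i e.
Proof.
move=> Pm Pex.
have Pex' i : exists e, 0 < e /\ P i e by have [e ? ?] := Pex i; exists e.
have [f fP] := choice Pex'.
exists (\big[Num.min/1]_i f i).
  by apply: lt_bigmin => // i _; have [] := fP i.
by move=> i; apply: (Pm _ (f i)); [have [] := fP i | exact: bigmin_le].
Qed.

Section Alcove.
Variables (R : realType) (N : nat).
Local Notation vec := 'rV[R]_N.
Implicit Types (a b c : vec) (w : 'S_N * 'rV[int]_N).

(** The pair [w] stands for an element of the extended affine Weyl group of [GL_N], a permutation
    with an integral translation. *)
Definition waff w a : vec := \row_k (a 0 (w.1 k) + (w.2 0 k)%:~R).

Definition alcove c : Prop :=
  (forall k, 0 <= c 0 k <= 1) /\ (forall i j : 'I_N, (i <= j)%N -> c 0 i <= c 0 j).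

Lemma alcove0 : alcove 0.
Proof. by split=> [k|i j _]; rewrite !mxE ?lexx ?ler01. Qed.

Lemma enorm_waff w a b : enorm (waff w a - waff w b) = enorm (a - b).
Proof.
rewrite /enorm; congr Num.sqrt.
rewrite [RHS](reindex_inj (@perm_inj _ w.1)) /=.
by apply: eq_bigr => k _; rewrite !mxE; congr (_ ^+ 2); ring.
Qed.

Lemma waff_inj w : injective (waff w).
Proof.
move=> a b ab; apply/eqP; rewrite -subr_eq0; apply/eqP/enorm_eq0.
by rewrite -(enorm_waff w) ab subrr enorm0.
Qed.

Lemma waff_surj w a : exists b, a = waff w b.
Proof.
exists (\row_k (a 0 ((w.1^-1)%g k) - (w.2 0 ((w.1^-1)%g k))%:~R)).
by apply/rowP => k; rewrite !mxE permK subrK.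
Qed.

Lemma waff_conv w t a b :
  waff w ((1 - t) *: a + t *: b) = (1 - t) *: waff w a + t *: waff w b.
Proof. by apply/rowP => k; rewrite !mxE; ring. Qed.

(* Coordinate [None] is the constant [0], so that the functions
   [ecoord a i - ecoord a j - n] are all the walls of the alcoves. *)
Definition ecoord a (i : option 'I_N) : R := if i is Some k then a 0 k else 0.

Definition same_side a b : Prop := forall i j (n : int),
  0 <= (ecoord a i - ecoord a j - n%:~R) * (ecoord b i - ecoord b j - n%:~R).

(** Take the integer parts of the midpoint of [a] and [b] and sort its fractional parts. The
    resulting [w] serves both points, since no wall separates either of them from the midpoint. *)
Lemma same_side_alcove a b : same_side a b ->
  exists w c c', [/\ alcove c, alcove c', a = waff w c & b = waff w c'].
Proof.
move=> ss; pose m k : R := (a 0 k + b 0 k) / 2.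
pose n k : int := Num.floor (m k); pose f k : R := m k - (n k)%:~R.
pose le i j := f i <= f j.
have le_tr : transitive le by move=> i j k; exact: le_trans.
have le_refl : reflexive le by move=> i; exact: lexx.
have le_tot : total le by move=> i j; exact: le_total.
have [s sP] : exists s : 'S_N, forall i j : 'I_N, (i <= j)%N -> f (s i) <= f (s j).
  have /tuple_permP[s sE] : perm_eq (sort le (ord_tuple N)) (ord_tuple N).
    exact/permPl/perm_sort.
  exists s => i j ij.
  have st := sort_sorted le_tot (ord_tuple N).
  have sz : size (sort le (ord_tuple N)) = N by rewrite size_sort size_tuple.
  have nthE (k : 'I_N) : nth i (sort le (ord_tuple N)) k = s k.
    by rewrite sE -(tnth_nth i) tnth_mktuple tnth_ord_tuple.
  have := sorted_leq_nth le_tr le_refl i st.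
  move=> /(_ i j); rewrite !inE sz !ltn_ord => /(_ isT isT ij).
  by rewrite !nthE.
(* Here [x] and [y] will be the values of a wall function at the two points, and [x + y] twice its
   value at the midpoint. *)
have pos (x y : R) : 0 <= x * y -> 0 <= x + y -> 0 <= x.
  move=> xy xy0; rewrite leNgt; apply/negP => x0.
  have : 0 < y by lra.
  by move=> y0; move: xy; rewrite leNgt nmulr_rlt0// y0.
have fn k : (n k)%:~R <= m k by exact: floor_le.
have fn1 k : m k < (n k)%:~R + 1 by rewrite -(intrD _ _ 1) floorD1_gt.
have mm k : a 0 k + b 0 k = m k + m k by rewrite /m; field.
have ssC : same_side b a by move=> i j l; rewrite mulrC; exact: ss.
have key u v : same_side u v -> (forall k, u 0 k + v 0 k = m k + m k) ->
    alcove (\row_k (u 0 (s k) - (n (s k))%:~R)).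
  move=> uv uvm; split=> [k|i j ij].
    rewrite !mxE; apply/andP; split.
      apply: (pos _ (v 0 (s k) - (n (s k))%:~R)).
        by have := uv (Some (s k)) None (n (s k)); rewrite /= !subr0.
      by have := fn (s k); have := uvm (s k); lra.
    rewrite -subr_ge0; apply: (pos _ (1 - (v 0 (s k) - (n (s k))%:~R))).
      have := uv (Some (s k)) None (n (s k) + 1).
      rewrite /= !subr0 !intrD -mulrNN => H; apply: le_trans H _.
      by rewrite le_eqVlt; apply/orP; left; apply/eqP; ring.
    by have := fn1 (s k); have := uvm (s k); lra.
  rewrite !mxE -subr_ge0.
  apply: (pos _ (v 0 (s j) - (n (s j))%:~R - (v 0 (s i) - (n (s i))%:~R))).
    have := uv (Some (s j)) (Some (s i)) (n (s j) - n (s i)).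
    rewrite /= !intrB => H; apply: le_trans H _.
    by rewrite le_eqVlt; apply/orP; left; apply/eqP; ring.
  have := sP _ _ ij; rewrite /f.
  by have := uvm (s i); have := uvm (s j); lra.
exists ((s^-1)%g, \row_k n k), (\row_k (a 0 (s k) - (n (s k))%:~R)),
  (\row_k (b 0 (s k) - (n (s k))%:~R)).
split; [exact: key|by apply: key => // k; rewrite addrC mm| |].
- by apply/rowP => k; rewrite !mxE permKV subrK.
- by apply/rowP => k; rewrite !mxE permKV subrK.
Qed.

Lemma alcove_cover a : exists w c, alcove c /\ a = waff w c.
Proof.
have ss : same_side a a by move=> i j n; rewrite -expr2 sqr_ge0.
by have [w [c [c' [? ? ? ?]]]] := same_side_alcove ss; exists w, c.
Qed.

Lemma ecoord_dist a b i : `|ecoord a i - ecoord b i| <= enorm (a - b).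
Proof.
case: i => [k|] /=; last by rewrite subrr normr0 enorm_ge0.
by have := coord_le_enorm (a - b) k; rewrite !mxE.
Qed.

(** Integers are discrete and there are finitely many pairs of coordinates, so the walls that miss
    [a] stay at a positive distance from it. *)
Lemma alcove_local a : exists2 e : R, 0 < e & forall b, enorm (a - b) < e ->
  exists w c c', [/\ alcove c, alcove c', a = waff w c & b = waff w c'].
Proof.
pose P (ij : option 'I_N * option 'I_N) (e : R) := forall n : int,
  ecoord a ij.1 - ecoord a ij.2 = n%:~R \/
  e <= `|ecoord a ij.1 - ecoord a ij.2 - n%:~R|.
have [||e e0 eP] := @common_positive R _ P.
- move=> ij e e' Pe ee' n; have [?|?] := Pe n; [by left|right].
  exact: le_trans ee' _.
- by move=> ij; exact: int_gap.
(* A difference of two coordinates changes by at most twice [enorm (a - b)]. *)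
exists (e / 2); first by rewrite divr_gt0.
move=> b ab; apply: same_side_alcove => i j n.
have [->|] := eP (i, j) n; first by rewrite subrr mul0r.
rewrite /=; have := ecoord_dist a b i; have := ecoord_dist a b j.
move: (ecoord a i) (ecoord a j) (ecoord b i) (ecoord b j) => x y x' y'.
move=> /ler_normlP[h1 h2] /ler_normlP[h3 h4].
have [s0|s0] := ger0P (x - y - n%:~R) => h5; first by rewrite mulr_ge0//; lra.
by rewrite mulr_le0//; lra.
Qed.

(** The coordinates of [c - waff w c] have the form [c_k - c_j - n], hence are zero or bounded away
    from zero uniformly in [n]. *)
Lemma alcove_discrete c : exists2 e : R, 0 < e & forall w,
  enorm (c - waff w c) < e -> waff w c = c.
Proof.
pose P (ij : 'I_N * 'I_N) (e : R) := forall n : int,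
  c 0 ij.1 - c 0 ij.2 = n%:~R \/ e <= `|c 0 ij.1 - c 0 ij.2 - n%:~R|.
have [||e e0 eP] := @common_positive R _ P.
- move=> ij e e' Pe ee' n; have [?|?] := Pe n; [by left|right].
  exact: le_trans ee' _.
- by move=> ij; exact: int_gap.
exists e => // w we; apply/rowP => k; rewrite mxE.
have [/= <-|/=] := eP (k, w.1 k) (w.2 0 k); first by rewrite addrC subrK.
move=> h; have := le_lt_trans (coord_le_enorm (c - waff w c) k) we.
by rewrite !mxE opprD addrA ltNge h.
Qed.

Lemma alcove_cluster (c : nat -> vec) : (forall n, alcove (c n)) ->
  exists2 c', alcove c' & forall e, 0 < e -> forall n0,
    exists2 n, (n0 <= n)%N & enorm (c n - c') < e.
Proof.
move=> ac.
have box : compact [set v : vec | forall i, (`[0, 1]%classic : set R) (v ord0 i)].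
  apply: (@rV_compact _ _ (fun=> `[0, 1]%classic : set R)) => i.
    exact: segment_compact.
have [|c' [_ cl]] := box (c @ \oo)%classic (fmap_proper_filter _ _).
  by exists 0%N => // n _ /= i; rewrite in_itv /=; have [] := ac n.
have ap e : 0 < e -> forall n0, exists2 n, (n0 <= n)%N & enorm (c n - c') < e.
  move=> e0 n0.
  (* The cluster point is one for the sup norm; [N] coordinates of size [e / (N + 1)] add up to less
     than [e]. *)
  have d0 : 0 < e / N.+1%:R by rewrite divr_gt0.
  have An : (c @ \oo)%classic [set x | exists2 n, (n0 <= n)%N & x = c n]%classic.
    by exists n0 => // n /= n0n; exists n.
  have [x [[n n0n ->] [_ xb]]] := cl _ _ An (nbhsx_ballx c' _ d0).
  exists n => //; apply: le_lt_trans (enorm_le_sum _) _.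
  have le i : `|(c n - c') 0 i| <= e / N.+1%:R.
    by have := xb 0 i; rewrite /ball /= !mxE distrC => /ltW.
  apply: le_lt_trans (ler_sum _ (fun i _ => le i)) _.
  rewrite sumr_const card_ord -[X in X < _]mulr_natr mulrAC -mulrA gtr_pMr//.
  by rewrite ltr_pdivrMr// mul1r ltr_nat.
have lim e : 0 < e -> exists2 n, forall k, `|c n 0 k - c' 0 k| < e & alcove (c n).
  move=> e0; have [n _ nP] := ap e e0 0%N; exists n => // k.
  by have := le_lt_trans (coord_le_enorm _ k) nP; rewrite !mxE.
exists c' => //; split=> [k|i j ij].
  apply/andP; split; apply/ler_addgt0Pr => e e0.
    have [n /(_ k) nk [/(_ k)/andP[+ _] _]] := lim e e0.
    by move: nk; rewrite ltr_norml => /andP[]; lra.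
  have [n /(_ k) nk [/(_ k)/andP[_ +] _]] := lim e e0.
  by move: nk; rewrite ltr_norml => /andP[]; lra.
apply/ler_addgt0Pr => e e0.
have [n nk [_ /(_ i j ij)]] := lim _ (divr_gt0 e0 (ltr0n _ 2)).
move: (nk i) (nk j); rewrite !ltr_norml => /andP[? ?] /andP[? ?]; lra.
Qed.

(** The displacement of the isometry [waff w] is 2-Lipschitz, so a cluster point of a minimising
    sequence attains the infimum. *)
Lemma waff_displacement_min w : exists2 c, alcove c &
  forall c', alcove c' -> enorm (c - waff w c) <= enorm (c' - waff w c').
Proof.
pose f c := enorm (c - waff w c).
pose S : set R := [set f c | c in [set c | alcove c]]%classic.
have S0 : (S !=set0)%classic by exists (f 0); exists 0 => //; exact: alcove0.
have lbS : has_lbound S by exists 0 => _ [c _ <-]; exact: enorm_ge0.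
have hS : has_inf S by [].
have ex (n : nat) : exists c, alcove c /\ f c < inf S + n.+1%:R^-1.
  have n0 : 0 < n.+1%:R^-1 :> R by rewrite invr_gt0.
  by have [_ [c ? <-] ?] := inf_adherent n0 hS; exists c.
have [c cP] := choice ex.
have [|c' ac' cl] := @alcove_cluster c; first by move=> n; have [] := cP n.
exists c' => // d ad; apply: (@le_trans _ _ (inf S)); last first.
  by apply: ge_inf => //; exists d.
apply/ler_addgt0Pr => e e0.
have e3 : 0 < e / 3 by rewrite divr_gt0.
have [n0 _ n0P] := near_infty_natSinv_lt (PosNum e3).
have [n n0n cn] := cl _ e3 n0.
have [_ fn] := cP n; have := n0P n n0n; rewrite /= => ne.
have := enorm_triangle (c n) c' (waff w c').
have := enorm_triangle (waff w (c n)) (c n) (waff w c').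
rewrite enorm_waff (enorm_distC c' (c n)); rewrite /f in fn.
set q := _^-1 in fn ne; lra.
Qed.

End Alcove.

(** * From local to global nonexpansiveness *)

Section LocalIsometry.
Variables (R : realType) (M N : nat).

(** Along the segment from [a] to [b], let [S] be the set of times at which the bound holds. The
    local hypothesis at [sup S] shows that [sup S] belongs to [S] and cannot be less than 1. *)
Lemma local_nonexpansive (f : 'rV[R]_M -> 'rV[R]_N) :
  (forall a, exists2 e : R, 0 < e & forall b, enorm (a - b) < e ->
     enorm (f a - f b) <= enorm (a - b)) ->
  forall a b, enorm (f a - f b) <= enorm (a - b).
Proof.
move=> loc a b; pose g t : 'rV[R]_M := a + t *: (b - a).
set D := enorm (a - b); have D0 : 0 <= D := enorm_ge0 _.
have gd s t : enorm (g s - g t) = `|s - t| * D.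
  rewrite /D enorm_distC -enormZ; congr enorm.
  by apply/rowP => k; rewrite !mxE; ring.
pose S : set R := [set t | 0 <= t <= 1 /\ enorm (f a - f (g t)) <= t * D]%classic.
have S00 : S 0 by split; rewrite ?lexx ?ler01// /g scale0r addr0 subrr enorm0 mul0r.
have uS : has_ubound S by exists 1 => t [/andP[]].
have hS : has_sup S by split=> //; exists 0.
have s0 : 0 <= sup S by apply: ub_le_sup.
have s1 : sup S <= 1 by apply: ge_sup; [exists 0 | move=> t [/andP[]]].
have [e e0 eP] := loc (g (sup S)).
have D1 : 0 < D + 1 by lra.
(* Adding 1 covers the case [D = 0]. *)
pose d := e / (D + 1); have d0 : 0 < d by rewrite divr_gt0.
have dD t : `|sup S - t| < d -> enorm (g (sup S) - g t) < e.
  rewrite /d ltr_pdivlMr// => td; rewrite gd; apply: le_lt_trans td.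
  by rewrite ler_wpM2l// lerDl.
have Sup : S (sup S).
  split; first by rewrite s0 s1.
  have [t St td] := sup_adherent d0 hS.
  have ts : t <= sup S by exact: ub_le_sup.
  have [_ ft] := St.
  have st : `|sup S - t| < d by rewrite ger0_norm ?subr_ge0//; lra.
  have := eP _ (dD _ st); rewrite gd ger0_norm ?subr_ge0// enorm_distC.
  have := enorm_triangle (f (g t)) (f a) (f (g (sup S))).
  by rewrite mulrBl; lra.
have [s1'|s1'] := eqVneq (sup S) 1.
  have [_] := Sup; rewrite s1' mul1r; congr (enorm (_ - f _) <= _).
  by apply/rowP => k; rewrite !mxE; ring.
have sl : sup S < 1 by rewrite lt_neqAle s1'.
pose t := Num.min 1 (sup S + d / 2).
have d2 : 0 < d / 2 by rewrite divr_gt0.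
have st : sup S < t by rewrite /t lt_min sl ltrDl.
have td : t <= sup S + d / 2 by rewrite ge_min lexx orbT.
suff /(ub_le_sup uS) : S t by rewrite leNgt st.
split; first by rewrite ge_min lexx /= andbT (le_trans s0 (ltW st)).
have [_ ft] := Sup.
have std : `|sup S - t| < d.
  by rewrite distrC ger0_norm ?subr_ge0 ?(ltW st)//; lra.
have := eP _ (dD _ std); rewrite gd distrC ger0_norm ?subr_ge0 ?(ltW st)//.
have := enorm_triangle (f (g (sup S))) (f a) (f (g t)).
by rewrite mulrBl; lra.
Qed.

End LocalIsometry.

(** * Buildings given by charts *)

Section Building.
Variables (R : realType) (N : nat) (X : pointedType).
Local Notation vec := 'rV[R]_N.
Variable chart : (vec -> X) -> Prop.
Implicit Types (g h : vec -> X) (a b c : vec) (x y z : X).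

Definition chart_agree g h := forall c, alcove c -> g c = h c.

(** Building axioms in terms of charts of apartments. [chart_pair] puts two alcoves into one
    apartment and records their relative position [w]; [chart_inj] makes the retraction centred at
    an alcove single-valued. *)
Hypothesis chart_cover : forall x, exists g c, [/\ chart g, alcove c & x = g c].
Hypothesis chart_pair : forall g h, chart g -> chart h ->
  exists g' w, [/\ chart g', chart_agree g' g & forall c, alcove c ->
    h c = g' (waff w c)].
Hypothesis chart_waff : forall g w, chart g -> chart (g \o waff w).
Hypothesis chart_inj : forall g h a b, chart g -> chart h -> chart_agree g h ->
  g a = h b -> a = b.

(* [retract g x a]: the retraction onto the apartment of [g], centred at its
   fundamental alcove, sends [x] to [g a]. *)
Definition retract g x a := exists g', [/\ chart g', chart_agree g' g & x = g' a].

Lemma retract_chart g a : chart g -> retract g (g a) a.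
Proof. by move=> cg; exists g. Qed.

Lemma retract_uniq g x a b : retract g x a -> retract g x b -> a = b.
Proof.
move=> [g1 [c1 e1 x1]] [g2 [c2 e2 x2]]; apply: (chart_inj c1 c2).
  by move=> c ac; rewrite e1// e2.
by rewrite -x1 -x2.
Qed.

Lemma retract_alcove g h w : chart g -> chart h -> exists w',
  forall c, alcove c -> retract g (h (waff w c)) (waff w' c).
Proof.
move=> cg ch; have [g' [w' [cg' ag e]]] := chart_pair cg (chart_waff w ch).
by exists w' => c ac; exists g'; split=> //; exact: e.
Qed.

Lemma retract_ex g x : chart g -> exists a, retract g x a.
Proof.
move=> cg; have [h [c [ch ac ->]]] := chart_cover x.
have [g' [w' [cg' ag e]]] := chart_pair cg ch.
by exists (waff w' c); exists g'; split=> //; exact: e.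
Qed.

(** On each alcove of the apartment of [h] the retraction is an affine Weyl element, hence an
    isometry. Every point near a given one shares an alcove with it, so [local_nonexpansive]
    applies. *)
Lemma retract_nonexpansive g h a b a' b' : chart g -> chart h ->
  retract g (h a) a' -> retract g (h b) b' -> enorm (a' - b') <= enorm (a - b).
Proof.
move=> cg ch ra rb.
have [f fP] := choice (fun a => retract_ex (h a) cg).
rewrite (retract_uniq ra (fP a)) (retract_uniq rb (fP b)).
apply: local_nonexpansive => {ra rb a' b'}a'.
have [e e0 eP] := alcove_local a'; exists e => // b' /eP[w [c [c' [ac ac' -> ->]]]].
have [w' rw] := retract_alcove w cg ch.
rewrite (retract_uniq (fP _) (rw _ ac)) (retract_uniq (fP _) (rw _ ac')).
by rewrite !enorm_waff.
Qed.

(** Retracting each of the two apartments onto the other gives the two inequalities. *)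
Lemma chart_enorm_eq g h a b a' b' : chart g -> chart h ->
  g a = h a' -> g b = h b' -> enorm (a - b) = enorm (a' - b').
Proof.
move=> cg ch ea eb; apply/eqP; rewrite eq_le; apply/andP; split.
  apply: (retract_nonexpansive cg ch); rewrite -?ea -?eb; exact: retract_chart.
by apply: (retract_nonexpansive ch cg); rewrite ?ea ?eb; exact: retract_chart.
Qed.

Lemma common_chart x y : exists g a b, [/\ chart g, x = g a & y = g b].
Proof.
have [g [c [cg ac ->]]] := chart_cover x; have [h [d [ch ad ->]]] := chart_cover y.
have [g' [w [cg' ag e]]] := chart_pair cg ch.
by exists g', c, (waff w d); split=> //; [rewrite ag | rewrite e].
Qed.

(** The set is nonempty by [common_chart] and a singleton by [chart_enorm_eq]. *)
Definition bdist x y : R := get [set r | exists g a b,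
  [/\ chart g, x = g a, y = g b & r = enorm (a - b)]]%classic.

Lemma bdistE g a b : chart g -> bdist (g a) (g b) = enorm (a - b).
Proof.
move=> cg; rewrite /bdist; case: xgetP => [r _|/(_ (enorm (a - b)))].
  by move=> [h [a' [b' [ch ea eb ->]]]]; rewrite (chart_enorm_eq cg ch ea eb).
by case; exists g, a, b.
Qed.

Lemma retract_bdist g x y a b : chart g -> retract g x a -> retract g y b ->
  enorm (a - b) <= bdist x y.
Proof.
move=> cg; have [h [c [d [ch -> ->]]]] := common_chart x y => ra rb.
by rewrite bdistE//; exact: (retract_nonexpansive cg ch).
Qed.

Lemma bdistxx x : bdist x x = 0.
Proof.
have [g [c [cg _ ->]]] := chart_cover x.
by rewrite bdistE// subrr enorm0.
Qed.

Lemma bdist_ge0 x y : 0 <= bdist x y.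
Proof.
have [g [a [b [cg -> ->]]]] := common_chart x y.
by rewrite bdistE// enorm_ge0.
Qed.

Lemma bdist_positivity x y : bdist x y = 0 -> x = y.
Proof.
have [g [a [b [cg -> ->]]]] := common_chart x y.
by rewrite bdistE// => /enorm_eq0/eqP; rewrite subr_eq0 => /eqP ->.
Qed.

Lemma bdist_sym x y : bdist x y = bdist y x.
Proof.
have [g [a [b [cg -> ->]]]] := common_chart x y.
by rewrite !bdistE// enorm_distC.
Qed.

Lemma bdist_triangle y x z : bdist x z <= bdist x y + bdist y z.
Proof.
have [g [a [b [cg ex ez]]]] := common_chart x z.
(* The retraction of [y] onto an apartment through [x] and [z] is no farther from either of them
   than [y] is. *)
have [d rd] := retract_ex y cg.
rewrite {1}ex {1}ez bdistE//; apply: le_trans (enorm_triangle d _ _) _.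
apply: lerD; apply: (retract_bdist cg) => //; rewrite ?ex ?ez; exact: retract_chart.
Qed.

Lemma bdist_stewart g a b t z : chart g -> 0 <= t <= 1 ->
  bdist z (g ((1 - t) *: a + t *: b)) ^+ 2 <=
  (1 - t) * bdist z (g a) ^+ 2 + t * bdist z (g b) ^+ 2
  - t * (1 - t) * bdist (g a) (g b) ^+ 2.
Proof.
(* Retract onto the apartment from an alcove containing the point dividing the
   geodesic: distances to this point are preserved, the others do not increase. *)
move=> cg /andP[t0 t1].
have [w [m [am mE]]] := alcove_cover ((1 - t) *: a + t *: b).
have [a' aE] := waff_surj w a; have [b' bE] := waff_surj w b.
have mE' : m = (1 - t) *: a' + t *: b'.
  by apply: (@waff_inj _ _ w); rewrite waff_conv -aE -bE mE.
have cgw := chart_waff w cg.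
have [h [e [ch ae zE]]] := chart_cover z.
have [g' [w' [cg' ag hE]]] := chart_pair cgw ch.
have rz : retract (g \o waff w) z (waff w' e).
  by exists g'; split=> //; rewrite zE hE.
have -> : bdist z (g ((1 - t) *: a + t *: b)) = enorm (waff w' e - m).
  by rewrite mE zE hE// -[g _]/((g \o waff w) m) -ag// bdistE.
rewrite aE bE -[g _]/((g \o waff w) a') -[g _]/((g \o waff w) b').
rewrite [bdist (_ a') _]bdistE// mE' enorm_stewart lerD2r.
by apply: lerD; rewrite ler_wpM2l ?subr_ge0// ler_pXn2r ?nnegrE ?enorm_ge0 ?bdist_ge0//;
  apply: (retract_bdist cgw rz); exact: retract_chart.
Qed.

Lemma bdist_complete (x : nat -> X) :
  (forall e, 0 < e -> exists n0, forall n m, (n0 <= n)%N -> (n0 <= m)%N ->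
     bdist (x n) (x m) < e) ->
  exists y, forall e, 0 < e -> forall n0, exists2 n, (n0 <= n)%N &
     bdist (x n) y < e.
Proof.
(* If [c'] is a cluster point of the alcove coordinates of [x n], then the points
   with coordinates [c'] near [x n] are eventually constant by discreteness. *)
move=> cx.
have ex n : exists gc : (vec -> X) * vec,
    [/\ chart gc.1, alcove gc.2 & x n = gc.1 gc.2].
  by have [g [c [? ? ?]]] := chart_cover (x n); exists (g, c).
have [gc gcP] := choice ex.
pose g n := (gc n).1; pose c n := (gc n).2.
have cg n : chart (g n) by have [] := gcP n.
have ac n : alcove (c n) by have [] := gcP n.
have xE n : x n = g n (c n) by have [] := gcP n.
have [c' ac' cl] := alcove_cluster ac.
have [d d0 dP] := alcove_discrete c'.
have gdisc n m : bdist (g n c') (g m c') < d -> g n c' = g m c'.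
  have [g' [w [cg' ag hE]]] := chart_pair (cg n) (cg m).
  by rewrite hE// -ag// bdistE// => /dP ->.
(* One third for each leg of the path [g n c'], [x n], [x m], [g m c']. *)
have d3 : 0 < d / 3 by rewrite divr_gt0.
have [n0 n0P] := cx _ d3.
have [n n0n cn] := cl _ d3 n0.
exists (g n c') => e e0 n1.
have me : 0 < Num.min e (d / 3) by rewrite lt_min e0.
have [m] := cl _ me (maxn n0 n1).
rewrite geq_max lt_min => /andP[n0m n1m] /andP[cme cmd].
exists m => //.
have gm k : bdist (x k) (g k c') = enorm (c k - c') by rewrite xE bdistE.
suff -> : g n c' = g m c' by rewrite gm.
apply: gdisc.
have := bdist_triangle (x n) (g n c') (g m c').
have := bdist_triangle (x m) (x n) (g m c').
have := n0P _ _ n0n n0m.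
by rewrite (bdist_sym (g n c') (x n)) !gm; lra.
Qed.

Definition building_distance : complete_distance R :=
  CompleteDistance bdistxx bdist_positivity bdist_sym bdist_triangle
    bdist_complete.

Lemma building_CAT0 : CAT0 (cd_complete_metric building_distance).
Proof.
apply: stewart_CAT0 => p q.
have [g [a [b [cg pE qE]]]] := common_chart p q.
exists (fun t => g ((1 - t) *: a + t *: b)); split.
- by rewrite subr0 scale1r scale0r addr0.
- by rewrite subrr scale1r scale0r add0r.
- move=> s t _ _; rewrite !cd_mdistE /= pE qE !bdistE// -enormZ.
  have -> : (1 - s) *: a + s *: b - ((1 - t) *: a + t *: b) = - ((s - t) *: (a - b)).
    by apply/rowP => k; rewrite !mxE; ring.
  by rewrite enormN.
- move=> t; rewrite in_itv /= => t01 z; rewrite !cd_mdistE /= pE qE.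
  exact: bdist_stewart.
Qed.

Section Automorphism.
Variable f : X -> X.
Hypothesis chart_f : forall g, chart g -> chart (f \o g).

Lemma automorphism_isometry x y : bdist (f x) (f y) = bdist x y.
Proof.
have [g [a [b [cg -> ->]]]] := common_chart x y.
by rewrite -[f _]/((f \o g) a) -[f _]/((f \o g) b) !bdistE//; exact: chart_f.
Qed.

(* On the alcove of a chart the displacement is that of an affine Weyl group
   element, which is bounded when the displacement is. *)
Lemma automorphism_semisimple : exists x, forall y, bdist x (f x) <= bdist y (f y).
Proof.
have disp g : chart g -> exists w, forall c, alcove c ->
    bdist (g c) (f (g c)) = enorm (c - waff w c).
  move=> cg; have [g' [w [cg' ag hE]]] := chart_pair cg (chart_f cg).
  by exists w => c ac; rewrite -[f _]/((f \o g) c) hE// -ag// bdistE.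
have ex w : exists m : vec, alcove m /\
    forall c, alcove c -> enorm (m - waff w m) <= enorm (c - waff w c).
  by have [c ? ?] := waff_displacement_min R w; exists c.
have [m mP] := choice ex.
pose F w := enorm (m w - waff w (m w)).
(* [S] collects relative positions that do occur between an alcove and its image; the minimum is
   sought among them. *)
pose S w := exists2 g, chart g & forall c, alcove c ->
    bdist (g c) (f (g c)) = enorm (c - waff w c).
have [g0 [_ [cg0 _ _]]] := chart_cover point.
have [w0 w0P] := disp _ cg0.
have Sw0 : S w0 by exists g0.
(* Alcove coordinates lie in [[0, 1]], so the translation entries of [w] are at most [F w0 + 1] in
   absolute value. Only finitely many [w] can beat [w0], and the finite type [T] encodes them, with
   entries shifted by [M]. *)
have [M MP] : exists M : nat, forall w, F w <= F w0 -> forall k, (absz (w.2 0%R k) <= M)%N.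
  have B0 : 0 <= F w0 + 1 by rewrite addr_ge0 ?enorm_ge0.
  exists (Num.trunc (F w0 + 1)) => w Fw k.
  rewrite truncn_ge_nat// natr_absz intr_norm.
  have := le_trans (coord_le_enorm _ k) Fw; rewrite !mxE.
  have [[/(_ k)/andP[h1 h2] _] _] := mP w.
  have [[/(_ (w.1 k))/andP[h3 h4] _] _] := mP w.
  move=> /ler_normlP[h5 h6]; apply/ler_normlP; split; lra.
pose T := ('S_N * {ffun 'I_N -> 'I_(M + M).+1})%type.
pose wT (u : T) : 'S_N * 'rV[int]_N :=
  (u.1, \row_k ((u.2 k : nat)%:Z - M%:Z)).
have Tw w : F w <= F w0 -> exists u, wT u = w.
  move=> /MP wM; case: w wM => s n /= wM.
  exists (s, [ffun k => inord (absz (n 0%R k + M%:Z)%R)]).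
  congr pair; apply/rowP => k; rewrite !mxE ffunE.
  have := wM k; set z := n _ _ => h; rewrite inordK; lia.
have [u0 u0E] := Tw w0 (lexx _).
have Pu0 : `[< S (wT u0) >] by apply/asboolP; rewrite u0E.
case: (@arg_minP _ _ _ u0 (fun u => `[< S (wT u) >]) (fun u => F (wT u)) Pu0) => u /asboolP[g cg gP] uP.
exists (g (m (wT u))) => y; have [aw _] := mP (wT u).
rewrite gP//; have [h [c [ch ac ->]]] := chart_cover y.
have [w wP] := disp _ ch; rewrite wP//.
have [_ /(_ c ac)] := mP w; apply: le_trans.
case: (lerP (F w) (F w0)) => Fw.
  by have [v vE] := Tw w Fw; rewrite -vE; apply: uP; apply/asboolP; rewrite vE; exists h.
by apply: le_trans (ltW Fw); rewrite -u0E; exact: uP.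
Qed.

End Automorphism.

End Building.

(** * Norms over a discretely valued field *)

(* The opposite of a normalised discrete valuation; its value at 0 is junk. *)
Record degree_map (K : fieldType) := DegreeMap {
  dm_fun :> K -> int;
  dm_mul : forall x y, x != 0 -> y != 0 -> dm_fun (x * y) = dm_fun x + dm_fun y;
  dm_add : forall x y, x != 0 -> y != 0 -> x + y != 0 ->
    dm_fun (x + y) <= Num.max (dm_fun x) (dm_fun y);
  dm_unif : K;
  dm_unif_neq0 : dm_unif != 0;
  dm_unif1 : dm_fun dm_unif = 1 }.

Section AbsoluteValue.
Variables (R : realType) (K : fieldType) (deg : degree_map K).
Implicit Types x y : K.

(** With base [e], multiplying a basis vector by the uniformiser shifts its logarithmic weight by 1,
    which matches the integral translations of [waff]. *)
Definition kabs x : R := if x == 0 then 0 else expR (deg x)%:~R.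

Lemma kabs0 : kabs 0 = 0.
Proof. by rewrite /kabs eqxx. Qed.

Lemma kabsE x : x != 0 -> kabs x = expR (deg x)%:~R.
Proof. by rewrite /kabs => /negPf ->. Qed.

Lemma kabs_gt0 x : (0 < kabs x) = (x != 0).
Proof. by rewrite /kabs; case: eqP => _; rewrite ?ltxx ?expR_gt0. Qed.

Lemma kabs_ge0 x : 0 <= kabs x.
Proof. by rewrite /kabs; case: eqP => // _; exact: expR_ge0. Qed.

Lemma kabsM x y : kabs (x * y) = kabs x * kabs y.
Proof.
have [->|x0] := eqVneq x 0; first by rewrite mul0r kabs0 mul0r.
have [->|y0] := eqVneq y 0; first by rewrite mulr0 kabs0 mulr0.
by rewrite !kabsE ?mulf_neq0// dm_mul// intrD expRD.
Qed.

Lemma kabs1 : kabs 1 = 1.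
Proof.
have := kabsM 1 1; rewrite mulr1 => /eqP; rewrite -subr_eq0 -{1}[kabs 1]mulr1.
rewrite -mulrBr mulf_eq0 subr_eq0 => /orP[|/eqP //].
by rewrite gt_eqF// kabs_gt0 oner_eq0.
Qed.

Lemma kabsN x : kabs (- x) = kabs x.
Proof.
suff h : kabs (- 1) = 1 by rewrite -mulN1r kabsM h mul1r.
apply/eqP; rewrite -(@eqrXn2 _ 2) ?kabs_ge0// expr1n expr2 -kabsM mulrNN mulr1.
by rewrite kabs1.
Qed.

Lemma kabsV x : kabs x^-1 = (kabs x)^-1.
Proof.
have [->|x0] := eqVneq x 0; first by rewrite invr0 kabs0 invr0.
apply: (mulfI (x := kabs x)); first by rewrite gt_eqF ?kabs_gt0.
by rewrite -kabsM !divff ?kabs1// gt_eqF ?kabs_gt0.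
Qed.

Lemma kabsD x y : kabs (x + y) <= Num.max (kabs x) (kabs y).
Proof.
have [->|x0] := eqVneq x 0; first by rewrite add0r le_max lexx orbT.
have [->|y0] := eqVneq y 0; first by rewrite addr0 le_max lexx.
have [->|xy0] := eqVneq (x + y) 0; first by rewrite kabs0 le_max kabs_ge0.
rewrite !kabsE// le_max !ler_expR !ler_int -le_max; exact: dm_add.
Qed.

Lemma kabs_sum (I : finType) (F : I -> K) (B : R) : 0 <= B ->
  (forall i, kabs (F i) <= B) -> kabs (\sum_i F i) <= B.
Proof.
move=> B0 FB; elim/big_ind: _ => [|x y xB yB|i _]; rewrite ?kabs0//.
by apply: le_trans (kabsD x y) _; rewrite ge_max xB.
Qed.

Section Norms.
Variable N : nat.
Local Notation vec := 'rV[R]_N.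
Implicit Types (a b c : vec) (v z : 'cV[K]_N) (A B : 'M[K]_N).

Definition nu a v : R := \big[Num.max/0]_k (kabs (v k 0) * expR (a 0 k)).

Lemma le_nu a v k : kabs (v k 0) * expR (a 0 k) <= nu a v.
Proof. exact: le_bigmax. Qed.

Lemma nu_le a v (B : R) : 0 <= B -> (forall k, kabs (v k 0) * expR (a 0 k) <= B) ->
  nu a v <= B.
Proof. by move=> B0 vB; apply: bigmax_le. Qed.

Lemma nu_ge0 a v : 0 <= nu a v.
Proof. exact: bigmax_ge_id. Qed.

Lemma nuD a v z : nu a (v + z) <= Num.max (nu a v) (nu a z).
Proof.
apply: nu_le => [|k]; first by rewrite le_max nu_ge0.
rewrite mxE; apply: le_trans (_ : _ <= Num.max (kabs (v k 0)) (kabs (z k 0)) * expR (a 0 k)) _.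
  by rewrite ler_wpM2r ?expR_ge0 ?kabsD.
rewrite maxr_pMl ?expR_ge0// ge_max !le_max !le_nu /= orbT.
by [].
Qed.

Lemma nu_delta a k : nu a (delta_mx k 0) = expR (a 0 k).
Proof.
apply/le_anti/andP; split.
  apply: nu_le => [|j]; first exact: expR_ge0.
  by rewrite mxE eqxx andbT; case: eqP => [->|_]; rewrite ?kabs1 ?mul1r// kabs0 mul0r expR_ge0.
by have := le_nu a (delta_mx k 0) k; rewrite mxE !eqxx kabs1 mul1r.
Qed.

Lemma nu_attained a v : 0 < nu a v -> exists k, nu a v = kabs (v k 0) * expR (a 0 k).
Proof.
move=> v0; have [k _ vk] : exists2 k, true & nu a v <= kabs (v k 0) * expR (a 0 k).
  apply: contrapT => h; suff : nu a v < nu a v by rewrite ltxx.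
  rewrite {1}/nu; apply: bigmax_lt => // k _; rewrite ltNge; apply/negP => kv.
  by apply: h; exists k.
by exists k; apply/le_anti; rewrite vk le_nu.
Qed.

Lemma nu_expR_enorm a b v : nu a v <= expR (enorm (a - b)) * nu b v.
Proof.
apply: nu_le => [|k]; first by rewrite mulr_ge0 ?expR_ge0 ?nu_ge0.
apply: le_trans (_ : _ <= expR (enorm (a - b)) * (kabs (v k 0) * expR (b 0 k))) _.
  rewrite mulrCA ler_wpM2l ?kabs_ge0// -expRD ler_expR.
  have := le_trans (ler_norm _) (coord_le_enorm (a - b) k); rewrite !mxE; lra.
by rewrite ler_wpM2l ?expR_ge0// le_nu.
Qed.

(** Monomial matrices act on the standard apartment through the affine Weyl group. *)
Lemma nu_monomial (s : 'S_N) (u : 'I_N -> K) a v z : (forall k, u k != 0) ->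
  (forall k, v k 0 = u k * z (s k) 0) ->
  nu a z = nu (waff (s, \row_k - deg (u k)) a) v.
Proof.
move=> u0 vz; rewrite /nu (reindex_inj (@perm_inj _ s)) /=.
apply: eq_bigr => k _; rewrite vz kabsM !mxE /= expRD.
have h : kabs (u k) * expR (- deg (u k))%:~R = 1.
  by rewrite kabsE// -expRD mulrNz subrr expR0.
by rewrite -[LHS]mulr1 -[in LHS]h; ring.
Qed.

(** The Iwahori subgroup, as the pointwise stabiliser of the fundamental alcove. *)
Definition stab A := A \in unitmx /\ forall c, alcove c -> forall v, nu c (A *m v) = nu c v.

Lemma stab1 : stab 1%:M.
Proof. by split=> [|c _ v]; rewrite ?unitmx1 ?mul1mx. Qed.

Lemma stabM A B : stab A -> stab B -> stab (A *m B).
Proof.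
move=> [Au As] [Bu Bs]; split=> [|c ac v]; first by rewrite unitmx_mul Au.
by rewrite -mulmxA As// Bs.
Qed.

Lemma stabV A : stab A -> stab (invmx A).
Proof.
move=> [Au As]; split=> [|c ac v]; first by rewrite unitmx_inv.
by rewrite -(As c ac) mulKVmx.
Qed.

(* The coordinates are pairwise distinct modulo the integers. *)
Definition gen_pt : vec := \row_k (k%:R / N.+1%:R).

Lemma alcove_gen_pt : alcove gen_pt.
Proof.
split=> [k|i j ij]; rewrite !mxE.
  rewrite divr_ge0//= ler_pdivrMr// mul1r ler_nat; exact/ltnW/leqW.
by rewrite ler_pM2r ?invr_gt0// ler_nat.
Qed.

Lemma gen_pt_int (i j : 'I_N) (n : int) : gen_pt 0 i - gen_pt 0 j = n%:~R -> i = j.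
Proof.
rewrite !mxE -mulrBl => h.
have {h}h : (i%:R - j%:R)  = n%:~R * (N.+1)%:R :> R by rewrite -h divfK// pnatr_eq0.
have h' : (i%:Z - j%:Z) = n * (N.+1)%:Z.
  by apply/eqP; rewrite -(eqr_int R) intrB intrM; apply/eqP; exact: h.
have := ltn_ord i; have := ltn_ord j => ? ?.
have n0 : n = 0 by nia.
by apply: val_inj => /=; rewrite n0 in h'; lia.
Qed.

(** No wall [c_j - c_i = n] with [i != j] meets [gen_pt], so its side of such a wall contains the
    whole alcove: [i < j] forces [n <= 0], and [j < i] forces [n <= -1]. *)
Lemma gen_pt_le_alcove (i j : 'I_N) (n : int) c : alcove c -> i != j ->
  n%:~R + gen_pt 0 i <= gen_pt 0 j -> n%:~R + c 0 i <= c 0 j.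
Proof.
move=> [c01 cm] ij; rewrite !mxE => h.
have {h}h : n%:~R * (N.+1)%:R <= (j%:R - i%:R) :> R.
  have := ler_wpM2r (ler0n R N.+1) h.
  by rewrite mulrDl !divfK ?pnatr_eq0// lerBrDr.
have h' : n * (N.+1)%:Z <= j%:Z - i%:Z.
  by rewrite -(ler_int R) intrB intrM.
have := ltn_ord i; have := ltn_ord j => ? ?.
have /andP[ci0 ci1] := c01 i; have /andP[cj0 cj1] := c01 j.
have [lij|lji] := ltnP i j.
  have : n <= 0 by nia.
  by rewrite -(ler_int R) => n0; have := cm _ _ (ltnW lij); lra.
have : n <= -1.
  have : (i : nat) <> j by move=> e; case/eqP: ij; exact: val_inj.
  nia.
by rewrite -(ler_int R) => n0; lra.
Qed.

(** Column [k] of [A] has the same norm at [gen_pt] as the basis vector. If row [j] attains it, the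
    weights of [j] and [k] differ by an integer, so [j = k]. *)
Lemma stab_diag A k : stab A -> kabs (A k k) = 1.
Proof.
move=> [_ As]; have h := As _ alcove_gen_pt (delta_mx k 0).
rewrite nu_delta -colE in h.
have [|j jP] := @nu_attained gen_pt (col k A); first by rewrite h expR_gt0.
move: jP; rewrite h [col k A j 0]mxE => jP.
have Ajk : A j k != 0.
  by rewrite -kabs_gt0 -(pmulr_lgt0 _ (expR_gt0 (gen_pt 0 j))) -jP expR_gt0.
have jk : k = j.
  apply: (@gen_pt_int _ _ (deg (A j k))); apply: expR_inj.
  by rewrite expRB jP -kabsE// mulfK// gt_eqF ?expR_gt0.
rewrite -jk in jP; apply: (mulIf (x := expR (gen_pt 0 k))).
  by rewrite gt_eqF ?expR_gt0.
by rewrite -jP mul1r.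
Qed.

(** Evaluating at the basis vector [k] gives [expR a_k >= kabs (A k k) expR b_k = expR b_k]; the
    inverse of [A] gives the opposite inequality. *)
Lemma stab_coord_uniq A a b : stab A -> (forall v, nu a v = nu b (A *m v)) -> a = b.
Proof.
move=> sA ab.
have le B u w : stab B -> (forall v, nu u v = nu w (B *m v)) -> forall k, w 0 k <= u 0 k.
  move=> sB uw k; rewrite -ler_expR -(nu_delta u) uw -colE.
  apply: le_trans (le_nu _ _ k); by rewrite mxE stab_diag// mul1r.
apply/rowP => k; apply/le_anti/andP; split; last exact: (le A).
apply: (le (invmx A)) => [|v]; first exact: stabV.
by rewrite ab mulKVmx//; have [] := sA.
Qed.

(** Since [w *m u = 0], the inverse is [1 - u w]. The bound on entries says that [u w] does not
    increase the norms of the alcove, so neither the matrix nor its inverse does. *)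
Lemma stab_transvection (u : 'cV[K]_N) (w : 'rV[K]_N) : w *m u = 0 ->
  (forall c, alcove c -> forall k l,
     kabs (u k 0) * kabs (w 0 l) * expR (c 0 k) <= expR (c 0 l)) ->
  stab (1%:M + u *m w).
Proof.
move=> wu uw.
have le c v z : alcove c -> nu c (v + u *m (w *m z)) <= Num.max (nu c v) (nu c z).
  move=> ac; apply: le_trans (nuD _ _ _) _; rewrite ge_max !le_max lexx /=.
  apply/orP; right; apply: nu_le => [|k]; first exact: nu_ge0.
  rewrite mxE big_ord1 kabsM -ler_pdivlMr ?expR_gt0//.
  have [->|u0] := eqVneq (u k 0) 0.
    by rewrite kabs0 mul0r divr_ge0 ?expR_ge0 ?nu_ge0.
  rewrite mulrC -ler_pdivlMr ?kabs_gt0// mxE.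
  apply: kabs_sum => [|l]; first by rewrite !divr_ge0 ?expR_ge0 ?nu_ge0 ?kabs_ge0.
  rewrite kabsM ler_pdivlMr ?kabs_gt0// ler_pdivlMr ?expR_gt0//.
  apply: le_trans (le_nu c z l).
  have -> : kabs (w 0 l) * kabs (z l 0) * kabs (u k 0) * expR (c 0 k) =
    kabs (z l 0) * (kabs (u k 0) * kabs (w 0 l) * expR (c 0 k)) by ring.
  by rewrite ler_wpM2l ?kabs_ge0// uw.
have inv : (1%:M + u *m w) *m (1%:M - u *m w) = 1%:M.
  rewrite mulmxDl mul1mx mulmxBr mulmx1 mulmxA -(mulmxA u w u) wu mulmx0 mul0mx.
  by rewrite subr0 subrK.
have [Mu _] := mulmx1_unit inv.
split=> // c ac v; apply/le_anti/andP; split.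
  by have := le c v v ac; rewrite maxxx mulmxDl mul1mx mulmxA.
have {1}-> : v = (1%:M - u *m w) *m ((1%:M + u *m w) *m v).
  by rewrite mulmxA (mulmx1C inv) mul1mx.
set z := _ *m v; have := le c z (- z) ac.
have nuN : nu c (- z) = nu c z by apply: eq_bigr => k _; rewrite mxE kabsN.
by rewrite nuN maxxx mulmxBl mul1mx -!mulmxA !mulmxN.
Qed.

End Norms.
End AbsoluteValue.

(** * Affine Bruhat decomposition and the building of norms *)

Section Bruhat.
Variables (R : realType) (K : fieldType) (deg : degree_map K) (N : nat).
Implicit Types (A B : 'M[K]_N).
Local Notation stab := (@stab R K deg N).
Local Notation gen_pt := (gen_pt R N).
Local Notation kabs := (@kabs R K deg).

Definition cleared A (k : 'I_N) : bool :=
  [exists l, [forall k', (k' != k) ==> (A k' l == 0)] &&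
             [forall l', (l' != l) ==> (A k l' == 0)]].

Lemma clearedP A k : reflect (exists l, (forall k', k' != k -> A k' l = 0) /\
  (forall l', l' != l -> A k l' = 0)) (cleared A k).
Proof.
apply: (iffP existsP) => -[l].
  move=> /andP[/forallP h1 /forallP h2]; exists l.
  by split=> [k' nk|l' nl]; apply/eqP; [apply: (implyP (h1 k'))|apply: (implyP (h2 l'))].
move=> [h1 h2]; exists l; apply/andP; split; apply/forallP => x; apply/implyP => nx.
  by rewrite h1.
by rewrite h2.
Qed.

Lemma unitmx_row_neq0 A k : A \in unitmx -> exists l, A k l != 0.
Proof.
move=> Au; apply/existsP; apply: contraT => /existsPn h.
have : (A *m invmx A) k k = 0.
  rewrite mxE big1// => l _; have := h l; rewrite negbK => /eqP ->.
  by rewrite mul0r.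
by rewrite mulmxV// mxE eqxx => /eqP; rewrite oner_eq0.
Qed.

(** Transfers the maximality of a pivot [y], known at [gen_pt] only, to the whole alcove, as
    [stab_transvection] requires of the multiplier [x / y]. *)
Lemma kabs_ratio_alcove (x y : K) (k k' : 'I_N) (c : 'rV[R]_N) :
  y != 0 -> k' != k -> alcove c ->
  kabs x * expR (gen_pt 0 k') <= kabs y * expR (gen_pt 0 k) ->
  kabs (x / y) * expR (c 0 k') <= expR (c 0 k).
Proof.
move=> y0 kk ac h.
have [->|x0] := eqVneq x 0; first by rewrite mul0r kabs0 mul0r expR_ge0.
have xy0 : x / y != 0 by rewrite mulf_neq0 ?invr_eq0.
have : kabs (x / y) * expR (gen_pt 0 k') <= expR (gen_pt 0 k).
  by rewrite kabsM kabsV mulrAC ler_pdivrMr ?kabs_gt0// (mulrC (expR _)).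
rewrite kabsE// -!expRD !ler_expR; exact: gen_pt_le_alcove.
Qed.

Lemma clear_row A k0 : A \in unitmx -> ~~ cleared A k0 ->
  exists L B, [/\ stab L, stab B & (#|[pred k | ~~ cleared (L *m A *m B) k]| <
    #|[pred k | ~~ cleared A k]|)%N].
Proof.
move=> Au nk0; have [l0 Al0] := unitmx_row_neq0 k0 Au.
(* Choosing the pivot of largest weight with respect to a generic point puts the
   row and column operations into the stabiliser of the alcove. *)
pose wt (kl : 'I_N * 'I_N) : R :=
  kabs (A kl.1 kl.2) * expR (gen_pt 0 kl.1 - gen_pt 0 kl.2).
pose P := [pred kl : 'I_N * 'I_N | ~~ cleared A kl.1].
have P0 : P (k0, l0) by [].
case: (@arg_maxP _ _ _ _ P wt P0) => -[k l] /= nk kmax.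
have pk k' l' : ~~ cleared A k' -> wt (k', l') <= wt (k, l) by move=> ?; exact: kmax.
have wt0 : 0 < wt (k, l).
  apply: lt_le_trans (pk _ l0 nk0).
  by rewrite /wt /= mulr_gt0 ?expR_gt0// kabs_gt0.
have Akl : A k l != 0.
  by move: wt0; rewrite /wt /= pmulr_lgt0 ?expR_gt0// kabs_gt0.
(* The column attached to a cleared row vanishes in row [k], so it is not the pivot column. *)
have cl0 k' : cleared A k' -> A k' l = 0.
  move=> ck; have kk : k != k' by apply: contraNneq nk => ->.
  move/clearedP: ck => [l1 [h1 h2]]; apply: h2; apply/eqP => ll.
  by move: Akl; rewrite ll h1// eqxx.
(* [u] holds the multipliers clearing column [l], and [w] those clearing row [k]. *)
pose u : 'cV[K]_N := \col_k' (if k' == k then 0 else - (A k' l / A k l)).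
pose w : 'rV[K]_N := \row_l' (if l' == l then 0 else - (A k l' / A k l)).
pose ek : 'rV[K]_N := delta_mx 0 k. pose el : 'cV[K]_N := delta_mx l 0.
have eku : ek *m u = 0 by apply/matrixP => i j; rewrite -rowE !mxE eqxx.
have wel : w *m el = 0 by apply/matrixP => i j; rewrite -colE !mxE eqxx.
have sL : stab (1%:M + u *m ek).
  apply: stab_transvection => // c ac k' l'; rewrite !mxE eqxx /=.
  have [->|kk] := eqVneq k' k; first by rewrite kabs0 !mul0r expR_ge0.
  have [->|kl] := eqVneq l' k; last by rewrite kabs0 mulr0 mul0r expR_ge0.
  rewrite kabs1 mulr1 kabsN; apply: kabs_ratio_alcove => //.
  have [ck|nck] := boolP (cleared A k').
    by rewrite cl0// kabs0 mul0r mulr_ge0 ?kabs_ge0 ?expR_ge0.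
  have := pk _ l nck; rewrite /wt /= !expRB !mulrA ler_pM2r//.
  by rewrite invr_gt0 expR_gt0.
have sB : stab (1%:M + el *m w).
  apply: stab_transvection => // c ac k' l'; rewrite !mxE eqxx andbT.
  have [->|ll] := eqVneq l' l; first by rewrite kabs0 mulr0 mul0r expR_ge0.
  have [->|kl] := eqVneq k' l; last by rewrite kabs0 !mul0r expR_ge0.
  rewrite kabs1 mul1r kabsN; apply: kabs_ratio_alcove => //; first by rewrite eq_sym.
  have := pk _ l' nk; rewrite /wt /= !expRB !(mulrCA (kabs _)) ler_pM2l ?expR_gt0//.
  by rewrite ler_pdivrMr ?expR_gt0// mulrAC ler_pdivlMr ?expR_gt0.
exists (1%:M + u *m ek), (1%:M + el *m w); split=> //.
set H := _ *m _ *m _.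
have HE i j : H i j = A i j + u i 0 * A k j + (A i l + u i 0 * A k l) * w 0 j.
  have -> : H = A + u *m row k A + (col l A + u *m (row k A *m el)) *m w.
    rewrite /H mulmxDl mul1mx mulmxDr mulmx1 mulmxA.
    by rewrite (rowE k) (colE l) -/ek -/el mulmxDl -!mulmxA.
  rewrite !mxE !big_ord1 !mxE big_ord1 -colE !mxE.
  by [].
have Hl i : i != k -> H i l = 0.
  move=> ik; rewrite HE !mxE (negPf ik) eqxx mulr0 addr0 mulNr divfK// subrr.
  by [].
have Hk j : j != l -> H k j = 0.
  move=> jl; rewrite HE !mxE (negPf jl) eqxx !mul0r !addr0 mulrN mulrC divfK//.
  by rewrite subrr.
(* Cleared rows have zero multipliers and survive; row [k] joins them, so the count drops. *)
have mono i : cleared A i -> cleared H i.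
  move=> ci; have Ail := cl0 _ ci.
  have ik : i != k by apply: contraNneq nk => <-.
  move/clearedP: ci => [j [h1 h2]].
  have Akj : A k j = 0 by rewrite h1 // eq_sym.
  have ui : u i 0 = 0 by rewrite mxE (negPf ik) Ail mul0r oppr0.
  have jl : j != l by apply: contraNneq Akl => <-; rewrite Akj.
  have wj : w 0 j = 0 by rewrite mxE (negPf jl) Akj mul0r oppr0.
  apply/clearedP; exists j; split=> [i' ii|j' jj].
    by rewrite HE wj Akj !mulr0 !addr0 h1.
  by rewrite HE ui Ail !mul0r !addr0 mul0r addr0 h2.
apply: proper_card; apply/properP; split.
  by apply/fintype.subsetP => i; rewrite !inE; apply: contraNN; exact: mono.
exists k; rewrite !inE ?nk// negbK.
by apply/clearedP; exists l.
Qed.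

Lemma bruhat A : A \in unitmx -> exists L B, [/\ stab L, stab B &
  forall k, cleared (L *m A *m B) k].
Proof.
have [n] := ubnP #|[pred k | ~~ cleared A k]|.
elim: n A => // n IH A; rewrite ltnS => An Au.
have [/forallP h|/forallPn[k0 nk0]] := boolP [forall k, cleared A k].
  exists 1%:M, 1%:M; split; [exact: stab1|exact: stab1|].
  by rewrite mul1mx mulmx1.
have [L [B [sL sB lt]]] := clear_row Au nk0.
have [||L' [B' [sL' sB' h]]] := IH (L *m A *m B).
- exact: leq_trans lt An.
- by rewrite !unitmx_mul Au; case: sL sB => [-> _] [-> _].
exists (L' *m L), (B *m B'); split; [exact: stabM|exact: stabM|].
by move=> k; have := h k; rewrite !mulmxA.
Qed.

Lemma cleared_monomial A : A \in unitmx -> (forall k, cleared A k) ->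
  exists w : 'S_N * 'rV[int]_N, forall (a : 'rV[R]_N) v,
    nu deg a (invmx A *m v) = nu deg (waff w a) v.
Proof.
move=> Au cA; have ex k : exists l, (forall k', k' != k -> A k' l = 0) /\
  (forall l', l' != l -> A k l' = 0) by exact/clearedP.
have [f fP] := choice ex.
have Af k : A k (f k) != 0.
  have [l Akl] := unitmx_row_neq0 k Au.
  suff <- : l = f k by [].
  by apply/eqP; apply: contraNT Akl => /(proj2 (fP k)) ->.
have f_inj : injective f.
  move=> k k' ff; apply/eqP; apply: contraT => kk.
  by have := Af k; rewrite ff (proj1 (fP k') k)// eqxx.
exists (perm f_inj, \row_k - deg (A k (f k))) => a v.
apply: (@nu_monomial R K deg N (perm f_inj) (fun k => A k (f k))) => // k.
rewrite -{1}(mulKVmx Au v) mxE (bigD1 (f k))//= permE big1 ?addr0// => l lf.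
by rewrite (proj2 (fP k))// mul0r.
Qed.

End Bruhat.

(** * The building of split norms *)

Section NormBuilding.
Variables (R : realType) (K : fieldType) (deg : degree_map K) (N : nat).
Local Notation vec := 'rV[R]_N.
Local Notation nu := (@nu R K deg N).
Local Notation stab := (@stab R K deg N).

(** Points are functions, the basis being hidden in a proposition, so that different bases and
    weights of one norm give equal points. *)
Definition split_norm : Type := {f : 'cV[K]_N -> R |
  exists2 g : 'M[K]_N, g \in unitmx & exists a : vec, f = fun v => nu a (invmx g *m v)}.

HB.instance Definition _ := gen_eqMixin split_norm.
HB.instance Definition _ := gen_choiceMixin split_norm.

Definition norm_at (g : 'M[K]_N) (gu : g \in unitmx) (a : vec) : split_norm :=
  exist _ (fun v => nu a (invmx g *m v)) (ex_intro2 _ _ g gu (ex_intro _ a erefl)).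

HB.instance Definition _ := isPointed.Build split_norm (norm_at (unitmx1 K N) 0).

Lemma split_norm_eq (x y : split_norm) : sval x =1 sval y -> x = y.
Proof.
case: x y => f fP [g gP] /= fg; have e : f = g by exact/funext.
by rewrite e in fP *; congr exist; exact: Prop_irrelevance.
Qed.

Definition norm_chart (h : vec -> split_norm) : Prop :=
  exists2 g : 'M[K]_N, g \in unitmx & forall a v, sval (h a) v = nu a (invmx g *m v).

Lemma norm_at_chart g (gu : g \in unitmx) : norm_chart (norm_at gu).
Proof. by exists g. Qed.

Lemma norm_chart_waff h w : norm_chart h -> norm_chart (h \o waff w).
Proof.
move=> [g gu hE]; case: w => s n; set t := dm_unif deg.
have t0 : t != 0 := dm_unif_neq0 deg.
have degt (m : int) : deg (t ^ m) = m.
  have deg1 : deg 1 = 0.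
    have := dm_mul deg (oner_neq0 K) (oner_neq0 K).
    by rewrite mulr1 => /eqP; rewrite -{1}[deg 1]addr0 (inj_eq (addrI _)) => /eqP ->.
  have degn (k : nat) : deg (t ^+ k) = k%:Z.
    elim: k => [|k IH]; first by rewrite expr0 deg1.
    rewrite exprS dm_mul ?expf_neq0// IH dm_unif1; lia.
  case: m => k; first by rewrite -exprnP degn.
  have := dm_mul deg (expf_neq0 k.+1 t0) (expfz_neq0 (Negz k) t0).
  rewrite NegzE -exprnN mulfV ?expf_neq0// deg1 degn; lia.
(* [M'] is the monomial matrix inducing [(s, n)], with translation part [- deg (t ^ (- n_k)) = n_k];
   [M] is its inverse. *)
pose M : 'M[K]_N := \matrix_(j, k) (t ^ (n 0 k) *+ (j == s k)).
pose M' : 'M[K]_N := \matrix_(k, j) (t ^ (- n 0 k) *+ (j == s k)).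
have MM : M' *m M = 1%:M.
  apply/matrixP => i j; rewrite !mxE (bigD1 (s i))//= big1 ?addr0 => [|k kE].
    rewrite !mxE eqxx (inj_eq perm_inj); case: eqP => [->|_]; last by rewrite mulr0.
    by rewrite -expfzDr// addNr.
  by rewrite !mxE (negPf kE) mul0r.
have [M'u Mu] := mulmx1_unit MM.
exists (g *m M'); first by rewrite unitmx_mul gu.
move=> a v; rewrite /= hE.
set z := invmx (g *m M') *m v.
have vE : invmx g *m v = M' *m z.
  have gMu : g *m M' \in unitmx by rewrite unitmx_mul gu.
  by rewrite -[in LHS](mulKVmx gMu v) -/z -!mulmxA mulKmx.
have nE : \row_k - deg (t ^ (- n 0 k)) = n.
  by apply/rowP => k; rewrite !mxE degt opprK.
rewrite vE (@nu_monomial R K deg N s (fun k => t ^ (- n 0 k)) a (M' *m z)).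
- by rewrite nE.
- by move=> k; exact: expfz_neq0.
- move=> k; rewrite mxE (bigD1 (s k))//= big1 ?addr0 => [|j jk].
    by rewrite mxE eqxx.
  by rewrite mxE (negPf jk) mul0r.
Qed.

Lemma norm_chart_cover (x : split_norm) :
  exists h c, [/\ norm_chart h, alcove c & x = h c].
Proof.
have [g gu [a xE]] := svalP x.
have [w [c [ac aE]]] := alcove_cover a.
exists (norm_at gu \o waff w), c; split=> //.
  exact/norm_chart_waff/norm_at_chart.
by apply: split_norm_eq => v; rewrite xE aE.
Qed.

(** Write [A = L g^-1 g' B] with [A] monomial. Replacing the basis [g] by [g L^-1] leaves the alcove
    of [h] unchanged, [B] fixes the alcove of [k], and [A] gives the relative position [w]. *)
Lemma norm_chart_pair h k : norm_chart h -> norm_chart k ->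
  exists h' w, [/\ norm_chart h', chart_agree h' h & forall c, alcove c ->
    k c = h' (waff w c)].
Proof.
move=> [g gu hE] [g' g'u kE].
have Au : invmx g *m g' \in unitmx by rewrite unitmx_mul unitmx_inv gu.
have [L [B [sL sB cl]]] := bruhat R deg Au.
set A := L *m _ *m B in cl.
have Au' : A \in unitmx by rewrite !unitmx_mul unitmx_inv gu g'u; case: sL sB => [-> _] [-> _].
have [w wE] := cleared_monomial R deg Au' cl.
have [Lu _] := sL; have [Bu _] := sB.
have gLu : g *m invmx L \in unitmx by rewrite unitmx_mul gu unitmx_inv.
have gLV v : invmx (g *m invmx L) *m v = L *m (invmx g *m v).
  rewrite -[in RHS](mulKVmx gLu v) -mulmxA mulKmx// mulKVmx//.
exists (norm_at gLu), w; split; first exact: norm_at_chart.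
  by move=> c ac; apply: split_norm_eq => v; rewrite /= gLV hE; have [_ ->] := sL.
move=> c ac; apply: split_norm_eq => v; rewrite /= gLV kE -wE.
have [_ <-//] := stabV sB; congr (nu c _).
apply: (can_inj (mulKmx Au')); rewrite mulKVmx// /A -!mulmxA; congr (_ *m _).
by rewrite mulKVmx// mulKVmx.
Qed.

(** Agreement on the alcove puts the transition matrix into [stab], where [stab_coord_uniq]
    applies. *)
Lemma norm_chart_inj h k a b : norm_chart h -> norm_chart k -> chart_agree h k ->
  h a = k b -> a = b.
Proof.
move=> [g gu hE] [g' g'u kE] hk ab.
have Au : invmx g' *m g \in unitmx by rewrite unitmx_mul unitmx_inv g'u.
apply: (@stab_coord_uniq R K deg N (invmx g' *m g)) => [|v].
  split=> // c ac v; rewrite -mulmxA -kE -hk// hE mulKmx//.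
by rewrite -mulmxA -kE -ab hE mulKmx.
Qed.

Fact norm_mul_subproof (A : 'M[K]_N) (Au : A \in unitmx) (x : split_norm) :
  exists2 g : 'M[K]_N, g \in unitmx & exists a : vec,
    (fun v => sval x (invmx A *m v)) = fun v => nu a (invmx g *m v).
Proof.
have [g gu [a xE]] := svalP x.
have Agu : A *m g \in unitmx by rewrite unitmx_mul Au.
exists (A *m g) => //; exists a; apply/funext => v; rewrite xE.
by rewrite -{1}(mulKVmx Agu v) -!mulmxA mulKmx// mulKmx.
Qed.

Definition norm_mul (A : 'M[K]_N) (Au : A \in unitmx) (x : split_norm) : split_norm :=
  exist _ _ (norm_mul_subproof Au x).

Lemma norm_mul_chart (A : 'M[K]_N) (Au : A \in unitmx) h :
  norm_chart h -> norm_chart (norm_mul Au \o h).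
Proof.
move=> [g gu hE].
have Agu : A *m g \in unitmx by rewrite unitmx_mul Au.
exists (A *m g) => // a v; rewrite /= hE.
by rewrite -{1}(mulKVmx Agu v) -!mulmxA mulKmx// mulKmx.
Qed.

Definition norm_distance : complete_distance R :=
  building_distance norm_chart_cover norm_chart_pair norm_chart_waff norm_chart_inj.

(** This is what turns bounds on distances into bounds on matrix entries. *)
Lemma norm_le_dist (x y : split_norm) v :
  sval x v <= expR (bdist norm_chart x y) * sval y v.
Proof.
have [h [a [b [hC -> ->]]]] := common_chart norm_chart_cover norm_chart_pair x y.
rewrite (bdistE norm_chart_cover norm_chart_pair norm_chart_waff norm_chart_inj)//.
by have [g _ hE] := hC; rewrite !hE; exact: nu_expR_enorm.
Qed.

End NormBuilding.

(** * The action on the building *)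

Section NormAction.
Variables (R : realType) (K : fieldType) (deg : degree_map K) (N : nat).
Variables (G : groupType) (rho : G -> 'M[K]_N).
Hypothesis rho1 : rho 1%g = 1%:M.
Hypothesis rhoM : forall g h, rho (g * h)%g = rho g *m rho h.
Hypothesis rho_fin : forall B : R,
  finite_set [set g | forall i j, kabs R deg (rho g i j) <= B]%classic.

Let rhoVM g : rho g^-1%g *m rho g = 1%:M.
Proof. by rewrite -rhoM mulVg rho1. Qed.

Let rho_unit g : rho g \in unitmx.
Proof. by have [] := mulmx1_unit (rhoVM g). Qed.

Let rhoV g : invmx (rho g) = rho g^-1%g.
Proof. by rewrite -[RHS]mulmx1 -(mulmxV (rho_unit g)) mulmxA rhoVM mul1mx. Qed.

Lemma norm_action_exists : exists (X : completeMetricType R) (act : G -> X -> X),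
    [/\ CAT0 X, isometric_action act, proper_action act &
        semisimple_action act].
Proof.
pose X := cd_complete_metric (norm_distance R deg N).
pose act (g : G) (x : X) : X := norm_mul (rho_unit g) (x : split_norm R deg N).
have actE g x v : sval (act g x : split_norm R deg N) v =
    sval (x : split_norm R deg N) (rho g^-1%g *m v) by rewrite /= rhoV.
have isom g x y : mdist (act g x) (act g y) = mdist x y.
  rewrite !cd_mdistE; apply: automorphism_isometry; first exact: norm_chart_cover.
  - exact: norm_chart_pair.
  - exact: norm_chart_waff.
  - exact: norm_chart_inj.
  - by move=> h; exact: norm_mul_chart.
exists X, act; split.
- exact: building_CAT0.
- split=> // [x|g h x].
    by apply: split_norm_eq => v; rewrite actE invg1 rho1 mul1mx.
  by apply: split_norm_eq => v; rewrite !actE invgM rhoM mulmxA.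
- move=> x; exists 1 => //.
  pose x0 : X := norm_at deg (unitmx1 K N) (0 : 'rV[R]_N).
  pose D := mdist x x0.
  (* A matrix entry is compared along [x0], [x], [act g x], [x], [x0], of lengths at most [D], [2],
     [0] and [D] in the estimates, the middle one being the displacement; [act g] evaluates norms
     through [rho g^-1], hence the inverse. *)
  apply: (@sub_finite_set _ _ ((fun g => g^-1)%g @`
    [set g | forall i j, kabs R deg (rho g i j) <= expR (D + (2 + D))])%classic);
    last exact: finite_image.
  move=> g [z [[y /= xy <-] xgy]].
  have gx : mdist (act g x) x <= 2.
    apply: le_trans (metric_triangle _ (act g y) _) _.
    rewrite !ballEmdist /= in xy xgy.
    by rewrite isom (metric_sym _ x); lra.
  exists (g^-1)%g; last by rewrite invgK.
  move=> i j.
  have nx0 v : sval (x0 : split_norm R deg N) v = nu deg (0 : 'rV[R]_N) v.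
    by rewrite /= invmx1 mul1mx.
  have h1 : kabs R deg (rho g^-1%g i j) <=
      sval (x0 : split_norm R deg N) (rho g^-1%g *m delta_mx j 0).
    rewrite nx0 -colE; apply: le_trans _ (@le_nu R K deg N 0 _ i).
    by rewrite !mxE expR0 mulr1.
  apply: le_trans h1 _.
  apply: le_trans (norm_le_dist _ (x : split_norm R deg N) _) _.
  rewrite -actE -[X in _ <= X]mulr1 [X in _ <= expR X * _]addrC.
  apply: le_trans (ler_wpM2l (expR_ge0 _) (norm_le_dist _ (x : split_norm R deg N) _)) _.
  have h2 := norm_le_dist (x : split_norm R deg N) (x0 : split_norm R deg N) (delta_mx j 0).
  apply: le_trans (ler_wpM2l (expR_ge0 _) (ler_wpM2l (expR_ge0 _) h2)) _.
  rewrite nx0 nu_delta mxE expR0 mulr1 -!expRD mulr1 ler_expR.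
  have := gx; have := metric_sym x x0; rewrite /D !cd_mdistE /=; lra.
- move=> g.
  have [x xP] := automorphism_semisimple (@norm_chart_cover R K deg N)
    (@norm_chart_pair R K deg N) (@norm_chart_waff R K deg N)
    (@norm_chart_inj R K deg N) (norm_mul_chart (rho_unit g)).
  exists (x : X); apply/le_anti/andP; split.
    apply: lb_le_inf; first by exists (displacement act g x); exists x.
    by move=> _ [y _ <-]; exact: xP.
  apply: ge_inf; last by exists x.
  by exists 0 => _ [y _ <-]; exact: mdist_ge0.
Qed.

End NormAction.

(** * Degree on rational functions, finite balls *)

Section FractionDegree.
Variable A : idomainType.
Local Notation K := {fraction {poly A}}.
Local Notation "x %:F" := (@FracField.tofrac _ x).

Lemma fraction_repr (B : idomainType) (x : {fraction B}) :
  exists a b : B, b != 0 /\ x = a%:F / b%:F.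
Proof.
set r := generic_quotient.repr x; exists ((fraction.frac r).1), ((fraction.frac r).2); split; first exact: denom_ratioP.
have d0 : ((fraction.frac r).2)%:F != 0 :> {fraction B} by rewrite tofrac_eq0 denom_ratioP.
apply: (canRL (mulfK d0)); rewrite -[x]generic_quotient.reprK -/r; unlock FracField.tofrac.
rewrite -[LHS]FracField.pi_mul; apply/eqP; rewrite generic_quotient.piE /= FracField.equivfE.
rewrite /FracField.mulf /= !numden_Ratio ?oner_eq0 ?mulr1 ?denom_ratioP//.
by rewrite mulrC.
Qed.

(** The opposite of the valuation at infinity; the two offsets between size and degree cancel. *)
Definition fdeg (x : K) : int := xget 0 [set n | exists a b : {poly A},
  [/\ a != 0, b != 0, x = a%:F / b%:F & n = (size a)%:Z - (size b)%:Z]]%classic.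

Lemma fdegE (a b : {poly A}) : a != 0 -> b != 0 ->
  fdeg (a%:F / b%:F) = (size a)%:Z - (size b)%:Z.
Proof.
move=> a0 b0; rewrite /fdeg; case: xgetP => [n _|/(_ ((size a)%:Z - (size b)%:Z))].
  move=> [c [d [c0 d0 /eqP]]].
  rewrite eqr_div ?tofrac_eq0// -!tofracM tofrac_eq => /eqP ad ->.
  have := congr1 (fun p : {poly A} => size p) ad; rewrite !size_mul//.
  move: a0 b0 c0 d0; rewrite -!size_poly_gt0; lia.
by case; exists a, b.
Qed.

Lemma fraction_repr_neq0 (x : K) : x != 0 ->
  exists a b : {poly A}, [/\ a != 0, b != 0 & x = a%:F / b%:F].
Proof.
have [a [b [b0 xE]]] := fraction_repr x => x0; exists a, b; split=> //.
by apply: contraNneq x0 => a0; rewrite xE a0 tofrac0 mul0r.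
Qed.

Lemma fdeg_mul x y : x != 0 -> y != 0 -> fdeg (x * y) = fdeg x + fdeg y.
Proof.
move=> /fraction_repr_neq0[a [b [a0 b0 ->]]] /fraction_repr_neq0[c [d [c0 d0 ->]]].
rewrite mulf_div -!tofracM !fdegE ?mulf_neq0// !size_mul//.
move: a0 b0 c0 d0; rewrite -!size_poly_gt0; lia.
Qed.

Lemma fdeg_add x y : x != 0 -> y != 0 -> x + y != 0 ->
  fdeg (x + y) <= Num.max (fdeg x) (fdeg y).
Proof.
move=> /fraction_repr_neq0[a [b [a0 b0 ->]]] /fraction_repr_neq0[c [d [c0 d0 ->]]].
rewrite addf_div ?tofrac_eq0// -!tofracM -tofracD => ad0.
have {}ad0 : a * d + c * b != 0.
  by apply: contraNneq ad0 => ->; rewrite tofrac0 mul0r.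
rewrite !fdegE ?mulf_neq0// le_max.
have := size_polyD (a * d) (c * b); rewrite leq_max !size_mul//.
move: a0 b0 c0 d0; rewrite -!size_poly_gt0.
move: (size _) (size a) (size b) (size c) (size d) => s sa sb sc sd.
by move=> ? ? ? ? /orP[?|?]; apply/orP; [left|right]; lia.
Qed.

Lemma fdeg_poly (p : {poly A}) : p != 0 -> fdeg p%:F = (size p)%:Z - 1.
Proof.
by move=> p0; rewrite -[p%:F]divr1 -tofrac1 fdegE ?oner_neq0// size_poly1.
Qed.

Definition fraction_degree : degree_map K.
Proof.
apply: (@DegreeMap _ fdeg fdeg_mul fdeg_add ('X%:F)).
  by rewrite tofrac_eq0 polyX_eq0.
by rewrite fdeg_poly ?polyX_eq0// size_polyX.
Defined.

(** The degree is at most its exponential, which is the absolute value. *)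
Lemma kabs_poly_bounded (R : realType) (B : R) : exists n, forall p : {poly A},
  kabs R fraction_degree p%:F <= B -> (size p <= n)%N.
Proof.
exists (Num.trunc B).+2 => p pB.
have [->|p0] := eqVneq p 0; first by rewrite size_poly0.
move: pB; rewrite kabsE ?tofrac_eq0// -[_ (_ : K)]/(fdeg _) fdeg_poly// => pB.
have h : ((size p)%:Z - 1)%:~R <= B :> R.
  apply: le_trans pB; apply: le_trans (expR_ge1Dx _).
  by rewrite lerDr.
have := le_lt_trans h (truncnS_gt B).
rewrite -[_.+1%:R]/((Posz _)%:~R) ltr_int.
by move: (Num.trunc B) (size p) => t s; lia.
Qed.

End FractionDegree.

Section FiniteSets.
Local Open Scope classical_set_scope.

Lemma finite_set_fun (I : finType) (T : eqType) (S : set T) :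
  finite_set S -> finite_set [set f : I -> T | forall i, S (f i)].
Proof.
move=> /finite_seqP[s ->].
pose g (h : {ffun I -> 'I_(size s)}) i := tnth (in_tuple s) (h i).
apply: (@sub_finite_set _ _ (g @` setT)); last exact/finite_image/finite_finset.
move=> f fs; have ix i : (index (f i) s < size s)%N by rewrite index_mem; exact: fs.
exists [ffun i => Ordinal (ix i)] => //; apply/funext => i.
by rewrite /g ffunE (tnth_nth (f i)) /= nth_index//; exact: fs.
Qed.

Lemma finite_set_matrix (m n : nat) (T : choiceType) (S : set T) :
  finite_set S -> finite_set [set M : 'M[T]_(m, n) | forall i j, S (M i j)].
Proof.
move=> fS; pose g (f : 'I_m * 'I_n -> T) := \matrix_(i, j) f (i, j).
apply: (@sub_finite_set _ _ (g @` [set f | forall ij, S (f ij)])).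
  move=> M MS; exists (fun ij => M ij.1 ij.2); first by case.
  by apply/matrixP => i j; rewrite mxE.
exact/finite_image/finite_set_fun.
Qed.

Lemma finite_set_poly (A : nzRingType) (S : set A) n : finite_set S ->
  finite_set [set p : {poly A} | (size p <= n)%N /\ forall i, S p`_i].
Proof.
move=> fS; pose g (f : 'I_n -> A) := \poly_(i < n) oapp f 0 (insub i).
apply: (@sub_finite_set _ _ (g @` [set f | forall i, S (f i)])).
  move=> p [sp pS]; exists (fun i : 'I_n => p`_i) => //.
  apply/polyP => i; rewrite coef_poly; case: ltnP => [ii|ni].
    by rewrite insubT.
  by rewrite nth_default// (leq_trans sp).
exact/finite_image/finite_set_fun.
Qed.

End FiniteSets.

Section FiniteBalls.
Local Open Scope classical_set_scope.

(** The map [h] records a degree on [B] as the degree in the variable of [{poly k}]; this finiteness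
    is the source of properness. *)
Definition finite_balls (B k : idomainType) (h : B -> {poly k}) :=
  injective h /\ forall n, finite_set [set x | (size (h x) <= n)%N].

(* The total degree: [h'] multiplies the new variable by the variable of [{poly k}]. *)
Lemma finite_balls_poly (B k : idomainType) (h : {rmorphism B -> {poly k}}) :
  finite_balls h ->
  exists h' : {rmorphism {poly B} -> {poly {poly k}}}, finite_balls h'.
Proof.
move=> [h_inj h_fin].
pose h' : {rmorphism {poly B} -> {poly {poly k}}} :=
  swapXY \o (comp_poly ('X * ('X)%:P) \o map_poly h).
(* The term of degree [j] in the new variable is shifted by [j] in the outer one, so terms of
   different [j] cannot cancel. *)
have h'E (f : {poly B}) (i j : nat) : (h' f)`_(i + j)`_j = (h f`_j)`_i.
  rewrite /= coef_swapXY comp_polyE coef_sum.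
  under eq_bigr => l _ do
    rewrite exprMn -rmorphXn /= coefZ coefMC coefXn coef_map /= mulrA.
  have [lt|le] := ltnP j (size (map_poly h f)).
    rewrite (bigD1 (Ordinal lt))//= eqxx mulr1 big1 ?addr0 ?coefMXn ?ltnNge ?leq_addl ?addnK//.
    move=> l lj; rewrite (_ : (j == l) = false) ?mulr0 ?mul0r//.
    by apply: contraNF lj => /eqP jl; apply/eqP/val_inj.
  rewrite big1 => [|l _]; last first.
    by rewrite (_ : (j == l) = false) ?mulr0 ?mul0r// gtn_eqF// (leq_trans _ le).
  by rewrite coef0 -coef_map (nth_default _ le) coef0.
have sz (f : {poly B}) (j : nat) : f`_j != 0 -> (size (h f`_j)%R + j <= size (h' f))%N.
  move=> fj; have hfj : h f`_j != 0 by rewrite -(rmorph0 h) (inj_eq h_inj).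
  rewrite -[size _]prednK ?size_poly_gt0// addSn ltnNge; apply/negP => /leq_sizeP.
  move=> /(_ _ (leqnn _)) e; have := h'E f (size (h f`_j)).-1 j.
  by rewrite e coef0 => /esym/eqP; rewrite -/(lead_coef _) lead_coef_eq0 (negPf hfj).
have h'0 (f : {poly B}) : h' f = 0 -> f = 0.
  move=> f0; apply/polyP => j; rewrite coef0; apply/eqP; apply: contraT => /[dup] fj /sz.
  rewrite f0 size_poly0 leqn0 addn_eq0 size_poly_eq0 -(rmorph0 h) (inj_eq h_inj).
  by rewrite (negPf fj).
exists h'; split.
  by move=> f g fg; apply/eqP; rewrite -subr_eq0; apply/eqP/h'0; rewrite rmorphB fg subrr.
move=> n; apply: (sub_finite_set _ (finite_set_poly n (h_fin n))) => f /= fn; split.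
  apply/leq_sizeP => j nj; apply/eqP; apply: contraT => /[dup] fj /sz.
  have hfj : (0 < size (h f`_j)%R)%N.
    by rewrite size_poly_gt0 -(rmorph0 h) (inj_eq h_inj).
  by move: nj hfj fn; move: (size (h' f)) (size (h f`_j)) => u v; lia.
move=> j; have [->|/sz fj] := eqVneq (f`_j) 0; first by rewrite rmorph0 size_poly0.
by apply: leq_trans fn; apply: leq_trans fj; exact: leq_addr.
Qed.

End FiniteBalls.

(** * Noether normalisation *)

Fixpoint mvpoly (p n : nat) : idomainType :=
  if n is n'.+1 then {poly (mvpoly p n')} else 'F_p.

Lemma mvpoly_finite_balls (p n : nat) : exists (k : idomainType)
  (h : {rmorphism mvpoly p n -> {poly k}}), finite_balls h.
Proof.
elim: n => [|n [k [h hP]]].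
  exists 'F_p, (polyC : {rmorphism 'F_p -> {poly 'F_p}}); split; first exact: polyC_inj.
  move=> n; exact: (@finite_finset 'F_p).
have [h' h'P] := finite_balls_poly hP.
by exists {poly k}, h'.
Qed.

(** * Finitely generated subrings in characteristic [p] *)

Section CharacteristicHom.
Variables (F : fieldType) (p : nat) (charF : p \in [pchar F]).

Definition Fp_hom (x : 'F_p) : F := (x : nat)%:R.

Lemma natr_modFp (m : nat) : (m %% (Zp_trunc (pdiv p)).+2)%:R = m%:R :> F.
Proof.
rewrite (Fp_cast (pcharf_prime charF)) [in RHS](divn_eq m p) natrD natrM.
by rewrite (pcharf0 charF) mulr0 add0r.
Qed.

Fact Fp_hom_zmod_morphism : zmod_morphism Fp_hom.
Proof.
move=> x y; rewrite /Fp_hom /= natr_modFp natrD natr_modFp natrB ?(ltnW (ltn_ord y))//.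
have -> : (Zp_trunc (pdiv p)).+2%:R = 0 :> F.
  by rewrite (Fp_cast (pcharf_prime charF)) (pcharf0 charF).
by rewrite sub0r.
Qed.

Fact Fp_hom_monoid_morphism : monoid_morphism Fp_hom.
Proof.
split=> [|x y]; first by rewrite /Fp_hom /= modn_small.
by rewrite /Fp_hom /= natr_modFp natrM.
Qed.

Definition Fp_rmorphism : {rmorphism 'F_p -> F} :=
  HB.pack_for {rmorphism 'F_p -> F} Fp_hom
    (GRing.isZmodMorphism.Build _ _ Fp_hom Fp_hom_zmod_morphism)
    (GRing.isMonoidMorphism.Build _ _ Fp_hom Fp_hom_monoid_morphism).

Lemma mvpoly_hom_onto (s : seq F) : exists n (f : {rmorphism mvpoly p n -> F}),
  forall x, x \in s -> exists a, f a = x.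
Proof.
elim: s => [|y s [n [f fP]]]; first by exists 0%N, Fp_rmorphism.
have cf : commr_rmorph f y by move=> x; exact: mulrC.
exists n.+1, (horner_morph cf : {rmorphism {poly _} -> F}) => x.
rewrite inE => /predU1P[->|/fP[a <-]]; first by exists 'X; exact: horner_morphX.
by exists a%:P; exact: horner_morphC.
Qed.

End CharacteristicHom.

(** * Nagata's change of variables *)

Section Nagata.

(* Substituting [X + T^k] for [X] with [k] large makes the leading term in [X]
   dominate, hence makes the polynomial monic in [T] up to a unit. *)
Lemma lead_coef_shift (A : idomainType) (k : nat) (f : {poly {poly A}}) :
  (forall i, (size (f`_i)%R <= k)%N) -> f != 0 ->
  lead_coef (swapXY (f \Po ('X + ('X^k)%:P))) = (lead_coef (lead_coef f))%:P.
Proof.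
elim/poly_ind: f => [|f c IH]; first by rewrite eqxx.
move=> sz fc0.
have sc : (size c <= k)%N by have := sz 0%N; rewrite coefD coefMX coefC add0r.
have sf i : (size (f`_i)%R <= k)%N.
  by have := sz i.+1; rewrite coefD coefMX coefC addr0.
have lift (q : {poly A}) : size (q^:P) = size q by rewrite size_map_inj_poly//; exact: polyC_inj.
have [f0|f0] := eqVneq f 0.
  rewrite f0 mul0r add0r comp_polyC swapXY_polyC lead_coefC.
  by rewrite lead_coef_map_inj//; exact: polyC_inj.
have lcf : lead_coef (f * 'X + c%:P) = lead_coef f.
  rewrite lead_coefDl ?lead_coefMX//.
  by rewrite size_mulX// ltnS (leq_trans (size_polyC_leq1 _))// size_poly_gt0.
rewrite comp_poly_MXaddC rmorphD rmorphM rmorphD /= swapXY_X !swapXY_polyC map_polyXn.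
have k0 : (0 < k)%N.
  rewrite lt0n; apply: contraNneq f0 => k0; apply/eqP/polyP => i; rewrite coef0.
  by apply/eqP; rewrite -size_poly_leq0 -k0.
have szk : size ('X%:P + 'X^k : {poly {poly A}}) = k.+1.
  by rewrite addrC size_polyDl ?size_polyXn// ltnS (leq_trans (size_polyC_leq1 _)).
have lck : lead_coef ('X%:P + 'X^k : {poly {poly A}}) = 1.
  by rewrite addrC lead_coefDl ?lead_coefXn// size_polyXn ltnS (leq_trans (size_polyC_leq1 _)).
have IHf := IH sf f0.
have s0 : swapXY (f \Po ('X + ('X^k)%:P)) != 0.
  by rewrite -lead_coef_eq0 IHf polyC_eq0 !lead_coef_eq0.
have k1 : 'X%:P + 'X^k != 0 :> {poly {poly A}} by rewrite -size_poly_gt0 szk.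
(* In the new main variable [c] has size at most [k], less than the size of the product with a
   factor of degree [k]. *)
rewrite lead_coefDl ?lead_coefM ?lck ?mulr1 ?lcf//.
rewrite lift size_mul// szk addnS /= (leq_ltn_trans sc)//.
by rewrite -[X in (X < _)%N]add0n ltn_add2r size_poly_gt0.
Qed.

(** After exchanging the two outer variables, induction makes the leading coefficient have a unit as
    its own leading coefficient; [lead_coef_shift] then brings this unit to the top. *)
Lemma nagata (p n : nat) (fs : seq {poly (mvpoly p n)}) :
  exists t t' : {rmorphism {poly (mvpoly p n)} -> {poly (mvpoly p n)}},
    cancel t t' /\
    forall f, f \in fs -> f != 0 -> lead_coef (t f) \is a GRing.unit.
Proof.
elim: n fs => [|n IH] fs.
  exists (idfun : {rmorphism _ -> _}), (idfun : {rmorphism _ -> _}); split=> // f _ f0.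
  by rewrite unitfE lead_coef_eq0.
pose gs := flatten [seq (swapXY f : seq _) | f <- fs].
have [t0 [t0' [t0K t0u]]] := IH gs.
pose k := (\max_(c <- gs) size (t0 c))%N.
pose t : {rmorphism {poly (mvpoly p n.+1)} -> {poly (mvpoly p n.+1)}} :=
  swapXY \o (comp_poly ('X + ('X^k)%:P) \o (map_poly t0 \o swapXY)).
pose t' : {rmorphism {poly (mvpoly p n.+1)} -> {poly (mvpoly p n.+1)}} :=
  swapXY \o (map_poly t0' \o (comp_poly ('X - ('X^k)%:P) \o swapXY)).
exists t, t'; split=> [f|f ffs f0].
  rewrite /= swapXYK comp_polyXaddC_K -map_poly_comp_id0 ?rmorph0//.
  by rewrite (eq_map_poly (g := id)) ?map_poly_id ?swapXYK.
have t0_inj := can_inj t0K.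
have F0 : swapXY f != 0 by rewrite swapXY_eq0.
have gsP i : i \in (swapXY f : seq _) -> i \in gs.
  by move=> fi; apply/flatten_mapP; exists f.
rewrite /t /= lead_coef_shift ?map_poly_eq0_id0 ?rmorph0 ?lead_coef_eq0//.
- rewrite lead_coef_map_inj ?rmorph0// rmorph_unit// t0u ?lead_coef_eq0//.
  by apply: gsP; rewrite mem_nth// prednK// size_poly_gt0.
- move=> i; rewrite coef_map /=.
  have [lt|le] := ltnP i (size (swapXY f)); last first.
    by rewrite nth_default// rmorph0 size_poly0.
  by apply: (@leq_bigmax_seq _ gs xpredT (fun c => size (t0 c))) => //; apply: gsP; exact: mem_nth.
- by rewrite -(rmorph0 t0) (inj_eq t0_inj) lead_coef_eq0.
Qed.

End Nagata.

Section Span.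
Variables (F : fieldType) (B : idomainType) (f : {rmorphism B -> F}).

(** The [B]-submodule generated by [us], with [B] acting through [f]. *)
Fixpoint span (V : lmodType F) (us : seq V) (x : V) : Prop :=
  if us is u :: us' then exists c, span us' (x - f c *: u) else x = 0.

Variable V : lmodType F.
Implicit Types (us vs : seq V) (x y : V).

Lemma span0 us : span us 0.
Proof.
by elim: us => [|u us IH] //=; exists 0; rewrite rmorph0 scale0r subr0.
Qed.

Lemma spanD us x y : span us x -> span us y -> span us (x + y).
Proof.
elim: us x y => [|u us IH] x y /=; first by move=> -> ->; rewrite addr0.
move=> [c xc] [d yd]; exists (c + d).
by rewrite rmorphD scalerDl opprD addrACA; exact: IH.
Qed.

Lemma spanZ us c x : span us x -> span us (f c *: x).
Proof.
elim: us x => [|u us IH] x /=; first by move=> ->; rewrite scaler0.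
by move=> [d /IH xd]; exists (c * d); rewrite rmorphM -scalerA -scalerBr.
Qed.

Lemma span_mem us u : u \in us -> span us u.
Proof.
elim: us => //= v us IH; rewrite inE => /predU1P[->|/IH su].
  by exists 1; rewrite rmorph1 scale1r subrr; exact: span0.
by exists 0; rewrite rmorph0 scale0r subr0.
Qed.

Lemma span_sum us (I : Type) (r : seq I) (x : I -> V) :
  (forall i, span us (x i)) -> span us (\sum_(i <- r) x i).
Proof.
by move=> sx; elim/big_ind: _ => // [|*]; [exact: span0 | exact: spanD].
Qed.

Lemma span_trans us vs x : (forall u, u \in us -> span vs u) -> span us x -> span vs x.
Proof.
elim: us x => [|u us IH] x uv /=; first by move=> ->; exact: span0.
move=> [c /IH h]; rewrite -(subrK (f c *: u) x); apply: spanD.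
  by apply: h => v vu; apply: uv; rewrite inE vu orbT.
by apply: spanZ; apply: uv; rewrite mem_head.
Qed.

Lemma span_map (W : lmodType F) (g : V -> W) us x :
  (forall c y z, g (y - c *: z) = g y - c *: g z) ->
  span us x -> span (map g us) (g x).
Proof.
move=> g_lin; have g0 : g 0 = 0 by have := g_lin 1 0 0; rewrite !scale1r !subrr.
elim: us x => [|u us IH] x /=; first by move=> ->.
by move=> [c /IH h]; exists c; rewrite g_lin in h.
Qed.

End Span.

(** If [f] is not injective, a kernel element becomes monic up to a unit after [nagata]. Division by
    it leaves finitely many powers of the last variable as generators over the image of the
    remaining variables, to which induction applies. *)
Lemma noether (F : fieldType) (p n : nat) (f : {rmorphism mvpoly p n -> F}) :
  exists m (g : {rmorphism mvpoly p m -> F}) (us : seq F^o),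
  [/\ injective g, forall u, u \in us -> exists a, u = f a &
      forall a, span g us (f a)].
Proof.
elim: n f => [|n IH] f.
  exists 0%N, f, [:: 1 : F^o]; split; first exact: fmorph_inj.
    by move=> u; rewrite inE => /eqP ->; exists 1; rewrite rmorph1.
  by move=> a /=; exists a; rewrite -[_ *: _]/(_ * _) mulr1 subrr.
have [f_inj|] := pselect (injective f).
  exists n.+1, f, [:: 1 : F^o]; split=> //.
    by move=> u; rewrite inE => /eqP ->; exists 1; rewrite rmorph1.
  by move=> a /=; exists a; rewrite -[_ *: _]/(_ * _) mulr1 subrr.
move=> f_ninj.
have [q q0 fq] : exists2 q, q != 0 & f q = 0.
  apply: contrapT => h; apply: f_ninj => a b ab; apply/eqP; rewrite -subr_eq0.
  by apply: contraT => ab0; case: h; exists (a - b) => //; rewrite rmorphB ab subrr.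
have [t [t' [tK tu]]] := nagata [:: q].
pose g := t q; have gu : lead_coef g \is a GRing.unit by apply: tu => //; rewrite mem_head.
pose f' : {rmorphism {poly (mvpoly p n)} -> F} := f \o t'.
have f'g : f' g = 0 by rewrite /f' /g /= tK fq.
have [m [h [us [h_inj usP fs]]]] := IH (f' \o polyC : {rmorphism _ -> _}).
exists m, h, [seq u * f' 'X ^+ j | u <- us, j <- iota 0 (size g)]; split=> //.
  move=> x /allpairsP[[u j] [/= /usP[a ->] _ ->]].
  by exists (t' (a%:P * 'X^j)); rewrite !rmorphM !rmorphXn.
move=> a; have -> : f a = f' (t a) by rewrite /f' /= tK.
rewrite (Pdiv.IdomainUnit.divp_eq gu (t a)) rmorphD rmorphM f'g mulr0 add0r.
set r := (_ %% g); have sr : (size r < size g)%N.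
  by rewrite ltn_modp -lead_coef_eq0; apply: contraTneq gu => ->; rewrite unitr0.
rewrite -[r]coefK poly_def rmorph_sum /=.
apply: span_sum => j.
pose mulj (x : F^o) : F^o := x * f' 'X ^+ j.
have sm : span h (map mulj us) (mulj (f' (r`_j)%:P)).
  apply: (@span_map _ _ _ _ _ mulj _ _ _ (fs r`_j)) => c y z.
  by rewrite /mulj mulrBl -scalerAl.
have -> : f (t' (r`_j *: 'X^j)) = mulj (f' (r`_j)%:P).
  by rewrite -[f (t' _)]/(f' _) -mul_polyC rmorphM rmorphXn.
apply: (span_trans _ sm) => x /mapP[u uus ->].
by apply/span_mem/allpairs_f => //; rewrite mem_iota /= add0n (leq_trans (ltn_ord j))// ltnW.
Qed.

Section IndependentRows.
Variables (F : fieldType) (B : idomainType) (f : {rmorphism B -> F}) (d : nat).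
Hypothesis f_inj : injective f.

Definition independent N (b : 'M[F]_(N, d)) :=
  forall c : 'rV[B]_N, map_mx f c *m b = 0 -> c = 0.

Lemma independent_mx N (b : 'M[F]_(N, d)) k (C D : 'M[B]_(k, N)) : independent b ->
  map_mx f C *m b = map_mx f D *m b -> C = D.
Proof.
move=> ib CD; apply/eqP; rewrite -subr_eq0; apply/eqP/row_matrixP => i.
rewrite row0; apply: ib; rewrite map_row map_mxB -row_mul mulmxBl CD subrr.
by rewrite row0.
Qed.

(** Greedy choice: a vector with no nonzero multiple in the row module of [b] is added to [b];
    otherwise the multiplier [e] goes into the common denominator [D]. *)
Lemma maximal_independent (us : seq 'rV[F]_d) :
  exists N (b : 'M[F]_(N, d)) (D : B), [/\ D != 0, independent b,
    forall i, row i b \in us &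
    forall x, span f us x -> exists c : 'rV[B]_N, f D *: x = map_mx f c *m b].
Proof.
elim: us => [|u us [N [b [D [D0 ib bus bD]]]]].
  exists 0%N, 0, 1; split=> [||[]//|x /= ->]; first exact: oner_neq0.
    by move=> c _; apply/rowP => -[].
  by exists 0; rewrite scaler0 map_mx0 mul0mx.
have [[e [c [e0 ec]]]|h] := pselect (exists e (c : 'rV[B]_N),
    e != 0 /\ f e *: u = map_mx f c *m b).
  exists N, b, (D * e); split=> //; first by rewrite mulf_neq0.
    by move=> i; rewrite inE bus orbT.
  move=> x /= [c0 /bD[c1 c1E]]; exists (e *: c1 + (D * c0) *: c).
  rewrite map_mxD !map_mxZ mulmxDl -!scalemxAl -c1E -ec !scalerA !rmorphM /=.
  by rewrite scalerBr scalerA [f e * _]mulrC; rewrite -addrA mulrAC addNr addr0.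
exists (1 + N)%N, (col_mx u b), D; split=> //.
- move=> c; rewrite -[c]hsubmxK map_row_mx mul_row_col.
  set c0 := lsubmx c; set c1 := rsubmx c.
  have -> : map_mx f c0 *m u = f (c0 0 0) *: u.
    by apply/rowP => j; rewrite !mxE big_ord1 !mxE.
  have [c00|c00] := eqVneq (c0 0 0) 0.
    rewrite c00 rmorph0 scale0r add0r => /ib ->.
    by apply/rowP => j; rewrite !mxE; case: splitP => k _; rewrite ?ord1 ?c00 ?mxE.
  move/eqP; rewrite addr_eq0 => /eqP e; case: h; exists (c0 0 0), (- c1).
  by split=> //; rewrite map_mxN mulNmx.
- move=> i; case: (split_ordP i) => k ->; rewrite inE.
    by rewrite (_ : row _ _ = u) ?eqxx//; apply/rowP => j; rewrite mxE col_mxEu ord1.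
  by rewrite (_ : row _ _ = row k b) ?bus ?orbT//; apply/rowP => j; rewrite [LHS]mxE col_mxEd [RHS]mxE.
- move=> x /= [c0 /bD[c1 c1E]]; exists (row_mx (D * c0)%:M c1).
  rewrite map_row_mx mul_row_col -c1E map_scalar_mx mul_scalar_mx rmorphM /=.
  by rewrite scalerBr scalerA addrC subrK.
Qed.

End IndependentRows.

(** * A discrete representation of the linear group *)

Section LinearGroup.
Variables (F : fieldType) (p : nat) (charF : p \in [pchar F]) (d : nat).
Variables (G : groupType) (fgG : finitely_generated G).
Variables (r : {multiplicative G -> GL d F}) (r_inj : injective r).

Let rM g h : gl_mx (r (g * h)%g) = gl_mx (r g) *m gl_mx (r h).
Proof. by rewrite gmulfM. Qed.

Let r1 : gl_mx (r 1%g) = 1%:M.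
Proof.
have u := gl_mx_unit (r 1%g).
by rewrite -[LHS](mulKmx u) -rM mulg1 mulVmx.
Qed.

Lemma entries_fg : exists n (f : {rmorphism mvpoly p n -> F}),
  forall g i j, exists a, gl_mx (r g) i j = f a.
Proof.
have [s sP] := fgG.
pose es := [seq gl_mx (r g) ij.1 ij.2 | g <- s ++ map (fun g => g^-1)%g s,
  ij <- enum {: 'I_d * 'I_d}].
have [n [f fP]] := mvpoly_hom_onto charF es.
exists n, f.
pose im x := exists a, x = f a.
have im_mul (A B : 'M[F]_d) : (forall i j, im (A i j)) -> (forall i j, im (B i j)) ->
    forall i j, im ((A *m B) i j).
  move=> iA iB i j; rewrite mxE; elim/big_ind: _ => [|x y [a ->] [b ->]|k _].
  - by exists 0; rewrite rmorph0.
  - by exists (a + b); rewrite rmorphD.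
  - have [a ->] := iA i k; have [b ->] := iB k j.
    by exists (a * b); rewrite rmorphM.
have im1 i j : im ((1%:M : 'M[F]_d) i j).
  by exists (i == j)%:R; rewrite mxE rmorph_nat.
(* Requiring the entries of the inverse as well makes [H] closed under inversion. *)
pose H : {pred G} := [pred g | `[< (forall i j, im (gl_mx (r g) i j)) /\
  (forall i j, im (gl_mx (r g^-1%g) i j)) >]].
suff HG g : g \in H by move=> g; have /asboolP[] := HG g.
apply: sP => [|{}g gs].
  split; first by apply/asboolP; rewrite invg1 r1.
  move=> x y /asboolP[x1 x2] /asboolP[y1 y2]; apply/asboolP; split.
    by rewrite rM; exact: im_mul.
  by rewrite invgM invgK rM; exact: im_mul.
have es_im g' i j : g' \in s ++ map (fun g => g^-1)%g s -> im (gl_mx (r g') i j).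
  move=> gs'; have [|a <-] := fP (gl_mx (r g') i j); last by exists a.
  by apply/allpairsP; exists (g', (i, j)); rewrite mem_enum.
apply/asboolP; split=> i j; apply: es_im; rewrite mem_cat ?gs//.
by rewrite map_f// orbT.
Qed.

Lemma discrete_representation (R : realType) :
  exists (K : fieldType) (deg : degree_map K) N (rho : G -> 'M[K]_N),
  [/\ rho 1%g = 1%:M, forall g h, rho (g * h)%g = rho g *m rho h &
   forall C : R, finite_set [set g | forall i j, kabs R deg (rho g i j) <= C]%classic].
Proof.
have [n [f fP]] := entries_fg.
have [m [psi [us [psi_inj usP fs]]]] := noether f.
(* Generators, over the polynomial ring, of the row vectors with entries in the image of [f]. *)
pose U : seq 'rV[F]_d := [seq u *: delta_mx 0 i | u <- us, i <- enum 'I_d].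
have spanU (x : 'rV[F]_d) : (forall i, exists a, x 0 i = f a) -> span psi U x.
  move=> xf; rewrite (matrix_sum_delta x) big_ord1; apply: span_sum => i.
  have [a ->] := xf i.
  have sm := span_map (g := fun y : F^o => (y : F) *: (delta_mx 0 i : 'rV[F]_d)) _ (fs a).
  apply: (span_trans _ (sm _)) => [y /mapP[u uus ->]|c y z]; last first.
    by rewrite scalerBl scalerA.
  by apply/span_mem/allpairs_f => //; rewrite mem_enum.
have [N [b [D [D0 ib bU bD]]]] := maximal_independent psi U.
have psiD : psi D != 0 by rewrite -(rmorph0 psi) (inj_eq psi_inj).
(* The rows of [b] have entries in the image of [f], and so do their products with [r g]; hence [D]
   clears the denominators. *)
have exC g : exists C : 'M[mvpoly p m]_N, psi D *: (b *m gl_mx (r g)) = map_mx psi C *m b.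
  have exc i : exists c : 'rV[mvpoly p m]_N, psi D *: (row i b *m gl_mx (r g)) = map_mx psi c *m b.
    apply/bD/spanU => j; have /allpairsP[[u k] [/= /usP[a ->] _ ->]] := bU i.
    have [a' a'E] := fP g k j; exists (a * a').
    by rewrite -scalemxAl mxE -rowE mxE a'E rmorphM.
  have [c cP] := choice exc; exists (\matrix_i c i).
  by apply/row_matrixP => i; rewrite linearZ /= !row_mul -map_row rowK cP.
have [C CP] := choice exC.
have [k [h [h_inj h_fin]]] := mvpoly_finite_balls p m.
pose K := {fraction {poly k}}.
pose eta : {rmorphism mvpoly p m -> K} := @FracField.tofrac _ \o h.
have eta_D : eta D != 0.
  by rewrite tofrac_eq0 -(rmorph0 h) (inj_eq h_inj).
exists K, (fraction_degree k), N, (fun g => (eta D)^-1 *: map_mx eta (C g)); split.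
- have -> : C 1%g = D%:M.
    apply: (independent_mx ib); rewrite -CP r1 mulmx1 map_scalar_mx mul_scalar_mx.
    by [].
  by rewrite map_scalar_mx scale_scalar_mx mulVf.
- move=> g1 g2.
  have CC : D *: C (g1 * g2)%g = C g1 *m C g2.
    apply: (independent_mx ib); rewrite map_mxZ map_mxM -scalemxAl -CP.
    rewrite -[RHS]mulmxA -CP -scalemxAr mulmxA -CP rM mulmxA.
    by rewrite scalemxAl.
  rewrite -scalemxAl -scalemxAr scalerA -map_mxM -CC map_mxZ scalerA.
  by rewrite -mulrA mulVf// mulr1.
- move=> M.
  have [l lP] := @kabs_poly_bounded k R (M * kabs R (fraction_degree k) (eta D)).
  (* Every basis vector times [psi D] is a combination of the rows of [b], so [b *m r g] determines
     [r g]. *)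
  have C_inj : injective C.
    move=> g1 g2 C12; apply: r_inj; apply: val_inj => /=.
    have bb : b *m gl_mx (r g1) = b *m gl_mx (r g2).
      by apply: (scalerI psiD); rewrite !CP C12.
    apply/row_matrixP => i.
    have /bD[c cE] : span psi U (delta_mx 0 i).
      by apply: spanU => j; exists (i == j)%:R; rewrite mxE eqxx rmorph_nat eq_sym.
    apply: (scalerI psiD).
    by rewrite !rowE !scalemxAl cE -!mulmxA bb.
  have fin := finite_set_matrix N N (h_fin l).
  apply: (sub_finite_set _ (finite_preimage (f := C) _ fin)); last first.
    by move=> x y _ _; exact: C_inj.
  move=> g /= gM i j; apply: lP.
  have := gM i j; rewrite !mxE kabsM kabsV mulrC ler_pdivrMr//.
  by rewrite kabs_gt0.
Qed.

End LinearGroup.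

Theorem theorem2p3 (R : realType) (F : fieldType) (p : nat)
    (charF : p \in [pchar F]) (d : nat) (d_ge1 : (1 <= d)%N) (G : groupType)
    (fgG : finitely_generated G)
    (linG : isomorphic_to_subgroup G (GL d F)) :
  exists (X : completeMetricType R) (act : G -> X -> X),
    [/\ CAT0 X, isometric_action act, proper_action act &
        semisimple_action act].
Proof.
have [H [r [_ r_inj _]]] := linG.
have [K [deg [N [rho [rho1 rhoM rho_fin]]]]] := discrete_representation charF fgG r_inj R.
exact: norm_action_exists rho1 rhoM rho_fin.
Qed.
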